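(* Let $G$ be a locally compact groupoid over a paracompact space $X$, and suppose that the stability groupoid $G'=\{g\in G: r(g)=s(g)\}$ has open range map (i.e. the restriction $r|_{G'}:G'\to X$ is an open map). Let $\overline G=G/\!\sim$, where $g\sim h$ iff $r(g)=r(h)$ and $s(g)=s(h)$, be equipped with the quotient topology and the groupoid structure $[g][h]=[gh]$ for composable $g,h$ (with the same base $X$, range $r([g])=r(g)$ and source $s([g])=s(g)$). Then: (a) $\overline G$ is a locally compact groupoid, and the quotient map $G\to\overline G$ is open; (b) if the range map of $G$ is open, then so is the range map of $\overline G$; (c) if $\overline G$ admits a Haar system, then $G$ admits a Haar system.
   Context: A groupoid over a set $X$ is a small category with object set $X$ in which every arrow is invertible; $G$ denotes its set of arrows, with range and source maps $r,s:G\to X$, identity map $\varepsilon:X\to G$, composition $m$ defined on the set $G^{(2)}=\{(\alpha,\beta)\in G\times G: s(\alpha)=r(\beta)\}$ of composable pairs, and inversion $\iota$. A topological groupoid is a groupoid with topologies on $G$ and $X$ making $r,s,\varepsilon,m,\iota$ continuous ($G^{(2)}$ carries the subspace topology of $G\times G$). A locally compact groupoid is a topological groupoid in which $G$ and $X$ are locally compact Hausdorff spaces. The stability groupoid $G'$ is a closed subgroupoid of $G$ (a bundle of groups $G_x^x$ over $X$). For $x,y\in X$ write $G^x=\{g\in G: r(g)=x\}$ and $G_y^x=\{g\in G: s(g)=y,\ r(g)=x\}$. A Haar system on a locally compact groupoid $G$ is a family $(\mu^x)_{x\in X}$ of Radon measures on $G$ such that (a) $\operatorname{supp}(\mu^x)=G^x$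 for every $x\in X$; (b) $\int_G\phi(\alpha g)\,d\mu^{y}(g)=\int_G\phi(g)\,d\mu^{x}(g)$ for every $\phi\in C_c(G)$ and every $\alpha\in G_y^x$; (c) for every $\phi\in C_c(G)$ the map $x\mapsto\int_G\phi(g)\,d\mu^x(g)$ is continuous on $X$. *)

(* Defs.v *)
From HB Require Import structures.
From mathcomp Require Import all_boot all_order all_algebra.
From mathcomp Require Import all_classical all_reals all_analysis.
From mathcomp Require Import generic_quotient.
Set Implicit Arguments. Unset Strict Implicit. Unset Printing Implicit Defensive.
Import Order.TTheory GRing.Theory Num.Theory.
Import numFieldNormedType.Exports.
Local Open Scope classical_set_scope.
Local Open Scope ring_scope.

Definition open_map (A B : topologicalType) (f : A -> B) : Prop :=
  forall U : set A, open U -> open (f @` U).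

Definition paracompact (T : topologicalType) : Prop :=
  forall (I : Type) (U : I -> set T),
    (forall i, open (U i)) -> \bigcup_i U i = setT ->
    exists (J : Type) (V : J -> set T),
      [/\ (forall j, open (V j)),
          \bigcup_j V j = setT,
          (forall j, exists i, V j `<=` U i) &
          (forall x : T, exists N, nbhs x N /\
              finite_set [set j | V j `&` N !=set0])].

Definition lch_space (T : topologicalType) : Prop :=
  locally_compact [set: T] /\ hausdorff_space T.

(* A groupoid over X with arrow set G is given by range r, source s,
   identity e, composition m (a total function, only meaningful on the
   composable pairs s a = r b), and inversion i. *)

Definition composable (G X : Type) (r s : G -> X) : set (G * G) :=
  [set p | s p.1 = r p.2].

Definition is_groupoid (G X : Type) (r s : G -> X) (e : X -> G)
    (m : G -> G -> G) (i : G -> G) : Prop :=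
  [/\ (forall a b, s a = r b -> r (m a b) = r a /\ s (m a b) = s b),
      (forall a b c, s a = r b -> s b = r c -> m (m a b) c = m a (m b c)),
      (forall x, r (e x) = x /\ s (e x) = x),
      (forall a, m (e (r a)) a = a /\ m a (e (s a)) = a) &
      (forall a, [/\ r (i a) = s a, s (i a) = r a,
                     m a (i a) = e (r a) & m (i a) a = e (s a)])].

Definition is_topological_groupoid (G X : topologicalType) (r s : G -> X)
    (e : X -> G) (m : G -> G -> G) (i : G -> G) : Prop :=
  [/\ is_groupoid r s e m i,
      continuous r /\ continuous s,
      continuous e,
      {within composable r s, continuous (fun p : G * G => m p.1 p.2)} &
      continuous i].

Definition is_locally_compact_groupoid (G X : topologicalType) (r s : G -> X)
    (e : X -> G) (m : G -> G -> G) (i : G -> G) : Prop :=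
  [/\ is_topological_groupoid r s e m i, lch_space G & lch_space X].

Definition stab (G X : Type) (r s : G -> X) : set G := [set g | r g = s g].

Definition gsim (G : Type) (X : eqType) (r s : G -> X) : rel G :=
  fun g h => (r g == r h) && (s g == s h).

Lemma gsim_refl (G : Type) (X : eqType) (r s : G -> X) : reflexive (gsim r s).
Proof. by move=> g; rewrite /gsim !eqxx. Qed.

Lemma gsim_sym (G : Type) (X : eqType) (r s : G -> X) : symmetric (gsim r s).
Proof. by move=> g h; rewrite /gsim [r g == _]eq_sym [s g == _]eq_sym. Qed.

Lemma gsim_trans (G : Type) (X : eqType) (r s : G -> X) : transitive (gsim r s).
Proof.
rewrite /gsim => h g k /andP[/eqP -> /eqP ->] /andP[/eqP -> /eqP ->].
by rewrite !eqxx.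
Qed.

Definition gsim_equiv (G : choiceType) (X : eqType) (r s : G -> X) :
  equiv_rel G := EquivRel (gsim r s) (@gsim_refl G X r s) (@gsim_sym G X r s)
                          (@gsim_trans G X r s).

Definition Gbar (G : ptopologicalType) (X : topologicalType) (r s : G -> X)
  : ptopologicalType :=
  quotient_topology {eq_quot (gsim_equiv r s)}%qT.

Section QuotientGroupoid.
Local Open Scope quotient_scope.
Context (G : ptopologicalType) (X : topologicalType) (r s : G -> X)
        (e : X -> G) (m : G -> G -> G) (i : G -> G).

Definition qmap : G -> Gbar r s := \pi_(Gbar r s).
Definition qr (q : Gbar r s) : X := r (repr q).
Definition qs (q : Gbar r s) : X := s (repr q).
Definition qe (x : X) : Gbar r s := qmap (e x).
Definition qm (p q : Gbar r s) : Gbar r s := qmap (m (repr p) (repr q)).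
Definition qi (q : Gbar r s) : Gbar r s := qmap (i (repr q)).
End QuotientGroupoid.
Arguments qmap {G X} r s.
Arguments qr {G X} r s q.
Arguments qs {G X} r s q.
Arguments qe {G X} r s e x.
Arguments qm {G X} r s m p q.
Arguments qi {G X} r s i q.

Definition borel (T : ptopologicalType) := g_sigma_algebraType (@open T).

Section Haar.
Context (R : realType).
Local Open Scope ereal_scope.

(* Radon measure on a locally compact Hausdorff space (Folland's definition):
   Borel, finite on compacts, outer regular on Borel sets,
   inner regular on open sets *)
Definition radon_measure (T : ptopologicalType)
    (mu : {measure set (borel T) -> \bar R}) : Prop :=
  [/\ (forall K : set T, compact K -> mu K < +oo),
      (forall E : set (borel T), measurable E ->
         mu E = ereal_inf [set mu U | U in [set U : set T | open U /\ E `<=` U]]) &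
      (forall U : set T, open U ->
         mu U = ereal_sup [set mu K | K in [set K : set T | compact K /\ K `<=` U]])].

Definition msupp (T : ptopologicalType) (mu : {measure set (borel T) -> \bar R})
  : set T := [set g | forall U : set T, open U -> U g -> 0 < mu U].

Definition Cc (T : topologicalType) (phi : T -> R) : Prop :=
  continuous phi /\ compact (closure [set t | phi t != 0%R]).

Definition haar_system (G : ptopologicalType) (X : topologicalType)
    (r s : G -> X) (m : G -> G -> G)
    (mu : X -> {measure set (borel G) -> \bar R}) : Prop :=
  [/\ (forall x, radon_measure (mu x)),
      (forall x, msupp (mu x) = [set g | r g = x]),
      (forall phi : G -> R, Cc phi -> forall a : G,
         \int[mu (s a)]_(g in [set g | r g = s a]) (phi (m a g))%:E
         = \int[mu (r a)]_g (phi g)%:E) &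
      (forall phi : G -> R, Cc phi ->
         continuous (fun x : X => \int[mu x]_g (phi g)%:E))].

Definition has_haar_system (G : ptopologicalType) (X : topologicalType)
    (r s : G -> X) (m : G -> G -> G) : Prop :=
  exists mu : X -> {measure set (borel G) -> \bar R}, haar_system r s m mu.
End Haar.

(* Main.v *)
Require Import Defs.
From HB Require Import structures.
From mathcomp Require Import all_boot all_order all_algebra.
From mathcomp Require Import all_classical all_reals all_analysis.
From mathcomp Require Import generic_quotient measurable_realfun lra ring.
Local Open Scope classical_set_scope.
Local Open Scope ring_scope.
Set Implicit Arguments. Unset Strict Implicit. Unset Printing Implicit Defensive.
Import Order.TTheory GRing.Theory Num.Theory.
Import numFieldNormedType.Exports.

(** Every isotropy group carries a left Haar functional, obtained as an
    ultrafilter limit of Haar's covering numbers.  Openness of the range map of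
    the stability groupoid lets one move the translating elements continuously
    from one isotropy group to its neighbours; approximating two functions by
    combinations of translates of the same sharply concentrated function then
    shows that quotients of Haar functionals vary continuously.  A locally
    finite family of bumps, available since [X] is paracompact, supplies a
    global normalisation, and hence a continuous family of Haar functionals
    [I x] on the isotropy groups.  For [f] in [C_c(G)] the function
    [g |-> I (s g) (f (g .))] is invariant under right multiplication by
    isotropy, so it descends to [C_c] of the quotient, where it is integrated
    against the given Haar system; the Riesz representation theorem turns the
    resulting functionals into a Haar system on [G]. *)

(** * Locally compact Hausdorff spaces *)

(** The Haar functionals are chosen on each isotropy group separately, so nothing relates them on
    different fibres, and each is determined only up to a positive factor. A quotient of two values
    does not see that factor, which is why continuity is proved for quotients: the argument is the
    classical proof of uniqueness of Haar measure, run simultaneously on all nearby fibres.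
    Neighbouring isotropy groups need not be isomorphic and no map between them is given, so every
    comparison passes through functions defined on the whole of [G] and restricted to fibres.
    Integration on fibres is phrased with positive functionals on nonnegative compactly supported
    functions; measures on [G] appear only through the Riesz theorem. Base points are parametrised
    by a map [sg : Y -> X], because the integrand to which continuity is finally applied,
    [t |-> f (m g t)], varies with [g] in [G] and not only with its source. *)

Lemma compact_finite_cover (T : topologicalType) (K : set T) (U : T -> set T) :
  compact K -> (forall t, K t -> nbhs t (U t)) ->
  exists s : seq T, (forall t, t \in s -> K t) /\
    forall t, K t -> exists2 u, u \in s & U u t.
Proof.
move=> /compact_near_coveringP cK UK.
(* A property holds along [F] when it holds for all lists extending some finite list; the
   near-covering form of compactness then yields a single list serving all of [K]. *)
pose F : set_system (seq T) :=
  [set P | exists s0 : seq T, forall s : seq T, {subset s0 <= s} -> P s].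
have FF : Filter F.
  split.
  - by exists [::].
  - move=> P Q [s Ps] [s' Qs']; exists (s ++ s') => w sw; split.
      by apply: Ps => x xs; apply: sw; rewrite mem_cat xs.
    by apply: Qs' => x xs; apply: sw; rewrite mem_cat xs orbT.
  - by move=> P Q PQ [s Ps]; exists s => w /Ps /PQ.
have [|s0 Hs0] := cK _ F (fun s t => exists2 u : T, u \in s & K u /\ U u t) FF.
  move=> x Kx; exists (U x, [set s : seq T | x \in s]).
    by split; [exact: UK | exists [:: x] => s /=; apply; exact: mem_head].
  by move=> [t s] /= [Ut xs]; exists x.
exists [seq t <- s0 | `[< K t >]]; split.
  by move=> t; rewrite mem_filter => /andP[/asboolP].
move=> t Kt; have [u us [Ku Uu]] := Hs0 _ (fun x h => h) t Kt.
by exists u => //; rewrite mem_filter us andbT; apply/asboolP.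
Qed.

(** Local compactness supplies just one compact neighbourhood; regularity of that compact Hausdorff
    piece shrinks it into [U]. *)
Lemma lch_nbhs_compact (T : topologicalType) (t : T) (U : set T) :
  lch_space T -> nbhs t U -> exists2 C, compact C & C `<=` U /\ nbhs t C.
Proof.
move=> [lT hT] tU; have [V] := lT t I; rewrite withinET => tV [cV clV].
have [W tW WU] : filter_from (nbhs t) closure (U `&` V).
  by apply: (compact_regular hT cV tV); exact: filterI.
exists (closure W).
  apply: (subclosed_compact _ cV); first exact: closed_closure.
  by move=> x /WU[].
split; first by move=> x /WU[].
exact: filterS (@subset_closure _ _) tW.
Qed.

Lemma compact_nbhs_compact (T : topologicalType) (K U : set T) :
  lch_space T -> compact K -> open U -> K `<=` U ->
  exists2 C, compact C & C `<=` U /\ K `<=` C°.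
Proof.
move=> lT cK oU KU.
pose P (t : T) C := compact C /\ (C `<=` U /\ nbhs t C).
have /choice[f Hf] : forall t, exists C, K t -> P t C.
  move=> t; have [Kt|nKt] := pselect (K t); last by exists set0.
  have [|C cC CU] := @lch_nbhs_compact T t U lT; last by exists C.
  by apply: open_nbhs_nbhs; split => //; exact: KU.
have [|s [sK Ks]] := compact_finite_cover (U := fun t => (f t)°) cK.
  by move=> t /Hf[_ [_ ?]]; exact: nbhs_interior.
exists (\big[setU/set0]_(t <- [seq t <- s | t \in s]) f t).
  rewrite big_filter; apply: bigsetU_compact => t ts; exact: (Hf t (sK _ ts)).1.
rewrite -bigcup_seq; split.
  move=> x [t /=]; rewrite mem_filter => /andP[ts _].
  exact: (Hf t (sK _ ts)).2.1.
move=> x Kx; have [y ys fyx] := Ks _ Kx.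
apply: interiorS fyx => z fz; exists y => //=.
by rewrite mem_filter ys.
Qed.

(** * Urysohn and Tietze through the one-point compactification *)

Section LCH.
Context {R : realType} {T : topologicalType}.
Hypothesis lT : lch_space T.
Local Notation opc := (one_point_compactification T).

Let opc_normal : normal_space opc.
Proof.
case: lT => l h; apply: compact_normal.
  exact: one_point_compactification_hausdorff.
exact: one_point_compactification_compact.
Qed.

Let closed_Some_compact (K : set T) : compact K -> closed (Some @` K : set opc).
Proof.
case: lT => l h cK; apply: compact_closed.
  exact: one_point_compactification_hausdorff.
apply: continuous_compact cK; apply: continuous_subspaceT.
exact: one_point_compactification_some_continuous.
Qed.

(** [T] need not be normal, but its one-point compactification is; separating [K] there from the
    complement of [C°] makes the function vanish off the compact [C]. *)
Lemma lch_urysohn (K U : set T) : compact K -> open U -> K `<=` U ->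
  exists f : T -> R, [/\ continuous f, forall t, 0 <= f t <= 1,
    forall t, K t -> f t = 1 &
    exists2 C, compact C & C `<=` U /\ forall t, ~ C t -> f t = 0].
Proof.
move=> cK oU KU; have [C cC [CU KC]] := compact_nbhs_compact lT cK oU KU.
have /(@normal_separatorP R) nT := opc_normal.
have oC : open (Some @` (C°) : set opc).
  by apply: one_point_compactification_open_some; exact: open_interior.
have sep : (~` (Some @` (C°))) `&` (Some @` K) = set0 :> set opc.
  apply/disjoints_subset => -[x|] /= nC; last by move=> -[].
  by move=> [y Ky [yx]]; apply: nC; rewrite -yx; exists y; [exact: KC|].
have [f [cf f01 f0 f1]] := (@uniform_separatorP _ R _ _).1
  (nT _ _ (open_closedC oC) (closed_Some_compact cK) sep).
exists (f \o Some); split.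
- move=> t; apply: continuous_comp; last exact: cf.
  exact: one_point_compactification_some_continuous.
- by move=> t; have := f01 (f (Some t)) (ex_intro2 _ _ (Some t) I erefl);
  rewrite /= in_itv.
- by move=> t Kt; apply: f1; exists (Some t) => //; exists t.
- exists C => //; split => // t nCt; apply: f0; exists (Some t) => //= -[y Cy [yt]].
  by apply: nCt; rewrite -yt; exact: interior_subset.
Qed.

(** Vanishing off [K] lets [f] be extended by 0 to the point at infinity, continuously on a closed
    subset of a normal space. Multiplying by a bump equal to 1 on [K] gives compact support and
    changes nothing on [D], where [f] is 0 off [K]. *)
Lemma lch_tietze (D K : set T) (f : T -> R) : closed D -> compact K ->
  {within D, continuous f} -> (forall t, D t -> ~ K t -> f t = 0) ->
  exists g : T -> R, [/\ continuous g, forall t, D t -> g t = f t &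
    exists2 C, compact C & forall t, ~ C t -> g t = 0].
Proof.
move=> clD cK cf f0.
have [M M0 fM] : exists2 M : R, 0 < M & forall t, D t -> `|f t| <= M.
  have cDK : compact (D `&` K).
    rewrite setIC; apply: compact_closedI => //.
  have : compact (f @` (D `&` K)).
    by apply: continuous_compact cDK; apply: continuous_subspaceW cf => ? [].
  move=> /compact_bounded[M [_ HM]].
  exists (`|M| + 1); first by rewrite ltr_wpDl.
  move=> t Dt; have [Kt|nKt] := pselect (K t).
    apply: HM; last by exists t.
    by rewrite (le_lt_trans (ler_norm _)) // ltrDl.
  by rewrite f0 // normr0 addr_ge0.
pose D' : set opc := (Some @` D) `|` [set None].
pose f' : opc -> R := fun o => if o is Some t then f t else 0.
have clD' : closed D'.
  rewrite -[D']setCK; apply: open_closedC.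
  rewrite (_ : ~` D' = Some @` (~` D)).
    by apply: one_point_compactification_open_some; exact: closed_openC.
  apply/seteqP; split => [[x|] /= nD|[x|] /= [y nDy [] //]].
  - by exists x => // Dx; apply: nD; left; exists x.
  - by exfalso; apply: nD; right.
  - by move=> <- [[z Dz [zy]]|//]; apply: nDy; rewrite -zy.
have cf' : {within D', continuous f'}.
  apply/subspace_continuousP => -[x|] /=.
    move=> [[y Dy [<-]]|//] A /= fA.
    have /subspace_continuousP/(_ y Dy _ fA) := cf.
    rewrite /= !nbhs_simpl /within /=.
    move=> H; apply: (filterS _ H) => z Hz Dz.
    by apply: Hz; case: Dz => [[w Dw [<-]]|].
  (* The complement of [K] is a neighbourhood of infinity, and [f'] is 0 on its part in [D']. *)
  move=> _ A /= /nbhs_singleton A0; exists K; first by split => //;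
    apply: compact_closed => //; exact: lT.2.
  move=> [x|] /=.
    move=> [|//] [y nKy [<-]] [|//] [z Dz [zy]].
    have fy0 : f y = 0 by apply: f0 => //; rewrite -zy.
    by move: A0; rewrite /f' -fy0.
  by [].

have fM' : forall o : opc, D' o -> `|f' o| <= M.
  by move=> [t|] /= [[z Dz //= [<-]]|//]; [exact: fM|rewrite normr0 ltW].
have [g' [gf' cg' gM]] := continuous_bounded_extension opc_normal clD' M0 cf' fM'.
have [h [ch h01 h1 [C' cC' [_ h0]]]] := lch_urysohn cK openT (fun _ _ => I).
exists (fun t => h t * g' (Some t)); split.
- move=> t; apply: continuousM; first exact: ch.
  apply: (@continuous_comp T opc R Some g'); last exact: cg'.
  exact: one_point_compactification_some_continuous.
- move=> t Dt; rewrite -gf'; last by rewrite inE; left; exists t.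
  rewrite /f'; have [Kt|nKt] := pselect (K t); first by rewrite h1 // mul1r.
  by rewrite f0 // mulr0.
- by exists C' => // t nC; rewrite h0 // mul0r.
Qed.
End LCH.

(** * Nonnegative functions with compact support *)

Section Cplus.
Context {R : realType} {T : topologicalType}.
Implicit Types f g p : T -> R.

Definition Cplus (f : T -> R) : Prop :=
  [/\ continuous f, forall t, 0 <= f t &
      exists2 K, compact K & forall t, ~ K t -> f t = 0].

Lemma Cplus0 : Cplus (fun=> 0).
Proof.
by split=> //; [move=> t; exact: cst_continuous|exists set0 => //; exact: compact0].
Qed.

Lemma CplusD f g : Cplus f -> Cplus g -> Cplus (fun t => f t + g t).
Proof.
move=> [cf f0 [K cK fK]] [cg g0 [L cL gL]]; split.
- by move=> t; apply: continuousD; [exact: cf|exact: cg].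
- by move=> t; rewrite addr_ge0.
- exists (K `|` L); first exact: compactU.
  by move=> t /not_orP[nK nL]; rewrite fK // gL // addr0.
Qed.

Lemma CplusM f g : continuous f -> (forall t, 0 <= f t) -> Cplus g ->
  Cplus (fun t => f t * g t).
Proof.
move=> cf f0 [cg g0 [L cL gL]]; split.
- by move=> t; apply: continuousM; [exact: cf|exact: cg].
- by move=> t; rewrite mulr_ge0.
- by exists L => // t nL; rewrite gL // mulr0.
Qed.

Lemma CplusZ (a : R) f : 0 <= a -> Cplus f -> Cplus (fun t => a * f t).
Proof. by move=> a0; apply: CplusM => // t; exact: cst_continuous. Qed.

Lemma Cplus_le f g : continuous f -> (forall t, 0 <= f t <= g t) ->
  Cplus g -> Cplus f.
Proof.
move=> cf fg [_ _ [L cL gL]]; split => //; first by move=> t; case/andP: (fg t).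
exists L => // t /gL g0; have := fg t; rewrite g0 => /andP[a b].
by apply: le_anti; rewrite a b.
Qed.

Lemma Cplus_sum (I : Type) (s : seq I) (P : pred I) (f : I -> T -> R) :
  (forall i, P i -> Cplus (f i)) -> Cplus (fun t => \sum_(i <- s | P i) f i t).
Proof.
move=> Cf; elim: s => [|i s IH].
  by under eq_fun do rewrite big_nil; exact: Cplus0.
under eq_fun do rewrite big_cons; case Pi: (P i) => //.
by apply: CplusD => //; exact: Cf.
Qed.

Lemma Cplus_bounded f : Cplus f -> exists2 M : R, 0 < M & forall t, f t <= M.
Proof.
move=> [cf f0 [K cK fK]].
have /compact_bounded[M [_ HM]] : compact (f @` K).
  by apply: continuous_compact cK; exact: continuous_subspaceT.
exists (`|M| + 1); first by rewrite ltr_wpDl.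
move=> t; have [Kt|nKt] := pselect (K t); last by rewrite fK // addr_ge0.
apply: (le_trans (ler_norm _)); apply: HM; last by exists t.
by rewrite (le_lt_trans (ler_norm _)) // ltrDl.
Qed.

(* [f / p] is continuous since it vanishes near every point outside [K]. *)
Lemma Cplus_div f p K : hausdorff_space T -> Cplus f -> compact K ->
  (forall t, ~ K t -> f t = 0) -> continuous p ->
  (forall t, 0 <= p t) -> (forall t, K t -> 0 < p t) ->
  Cplus (fun t => f t / p t).
Proof.
move=> hT [cf f0 _] cK fK cp p0 pK; split.
- move=> t; have [Kt|nKt] := pselect (K t).
    apply: cvgM; first exact: cf.
    by apply: cvgV; [rewrite gt_eqF // pK|exact: cp].
  have : nbhs t (~` K).
    by apply: open_nbhs_nbhs; split => //; apply: closed_openC; exact: compact_closed.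
  move=> ntK; apply: (@cvg_trans _ ((fun=> 0 : R) @ t)).
    apply: near_eq_cvg; apply: filterS ntK => z nKz.
    by rewrite fK // mul0r.
  by rewrite fK // mul0r; exact: cvg_cst.
- by move=> t; rewrite divr_ge0.
- by exists K => // t nK; rewrite fK // mul0r.
Qed.

Lemma Cc_Cplus f : hausdorff_space T -> Cplus f <-> (Cc f /\ forall t, 0 <= f t).
Proof.
move=> hT; split.
  move=> [cf f0 [K cK fK]]; split => //; split => //.
  apply: (subclosed_compact _ cK); first exact: closed_closure.
  rewrite (closure_id K).1; last exact: compact_closed.
  by apply: closureS => t /= /eqP ft; apply: contrapT => /fK.
move=> [[cf cK] f0]; split => //; exists (closure [set t | f t != 0]) => //.
by move=> t nt; apply/eqP/negPn/negP => ft; apply: nt; exact: subset_closure.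
Qed.

Lemma lch_bump (K U : set T) : lch_space T -> compact K -> open U -> K `<=` U ->
  exists f : T -> R, [/\ Cplus f, forall t, f t <= 1,
    forall t, K t -> f t = 1 &
    exists2 C, compact C & C `<=` U /\ forall t, ~ C t -> f t = 0].
Proof.
move=> lT cK oU KU;
  have [f [cf f01 f1 [C cC [CU f0]]]] := @lch_urysohn R _ lT _ _ cK oU KU.
exists f; split => //; last by exists C.
  by split => //; [move=> t; case/andP: (f01 t)|exists C].
by move=> t; case/andP: (f01 t).
Qed.

Lemma lch_bump_pt (t : T) (U : set T) : lch_space T -> nbhs t U ->
  exists f : T -> R, [/\ Cplus f, forall z, f z <= 1, f t = 1 &
    exists2 C, compact C & C `<=` U /\ forall z, ~ C z -> f z = 0].
Proof.
move=> lT; rewrite nbhsE => -[V [oV Vt VU]].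
have [|f [Cf f1 ft [C cC [CV f0]]]] := lch_bump lT (@compact_set1 _ t) oV.
  by move=> _ ->.
exists f; split => //; first exact: ft.
by exists C => //; split => //; exact: subset_trans VU.
Qed.

(** A partition of unity multiplied by [f]: with [p] the sum of finitely many bumps, the pieces are
    [b u * (f / p)], and the division matters only on [K], where [p] is positive. *)
Lemma Cplus_decomp (f : T -> R) (K : set T) (U : T -> set T) :
  lch_space T -> Cplus f -> compact K -> (forall t, ~ K t -> f t = 0) ->
  (forall t, K t -> nbhs t (U t)) ->
  exists (s : seq T) (h : T -> T -> R),
    [/\ forall u, u \in s -> K u,
        forall u, u \in s -> [/\ Cplus (h u), forall t, h u t <= f t &
          exists2 C, compact C & C `<=` U u /\ forall t, ~ C t -> h u t = 0] &
        forall t, f t = \sum_(u <- s) h u t].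
Proof.
move=> lT Cf cK fK UK.
pose P (t : T) (b : T -> R) := [/\ Cplus b, b t = 1 &
  exists2 C, compact C & C `<=` U t /\ forall z, ~ C z -> b z = 0].
have /choice[b Hb] : forall t, exists b, K t -> P t b.
  move=> t; have [Kt|nKt] := pselect (K t); last by exists (fun=> 0).
  by have [b [? ? ? ?]] := lch_bump_pt lT (UK _ Kt); exists b.
have [|s [sK Ks]] := compact_finite_cover (U := fun t => [set z | 0 < b t z]) cK.
  move=> t /Hb[[cb _ _] bt _].
  by apply: (cb t [set r | 0 < r]); rewrite bt; apply: lt_nbhsr; exact: ltr01.
pose p t := \sum_(u <- s) b u t.
have bs u : u \in s -> P u (b u) by move=> /sK /Hb.
have Cp : Cplus p.
  rewrite /p; under eq_fun do rewrite big_seq_cond.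
  by apply: Cplus_sum => u /andP[/bs[]].
have [cp p0 _] := Cp.
have pK t : K t -> 0 < p t.
  move=> /Ks[u us bu]; rewrite /p (big_rem u) //= ltr_wpDr //.
  rewrite big_seq_cond; apply: sumr_ge0 => v;
    rewrite andbT => /mem_rem /bs[[_ + _] _ _].
  exact.
exists s, (fun u t => b u t * (f t / p t)); split => //.
- move=> u us; have [[cb b0 bC] bu [C cC [CU bC0]]] := bs _ us.
  split.
  + by apply: CplusM => //; apply: (Cplus_div lT.2 Cf cK).
  + move=> t; have [Kt|nKt] := pselect (K t); last by rewrite fK // mul0r mulr0.
    rewrite mulrCA ler_piMr //; first by case: Cf.
    rewrite ler_pdivrMr ?pK // mul1r /p (big_rem u) //= lerDl.
    rewrite big_seq_cond; apply: sumr_ge0 => v;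
      rewrite andbT => /mem_rem /bs[[_ + _] _ _].
    exact.
  + by exists C => //; split => // t nC; rewrite bC0 // mul0r.
- move=> t; rewrite -mulr_suml -/(p t); have [Kt|nKt] := pselect (K t).
    by rewrite mulrC divfK // gt_eqF // pK.
  by rewrite fK // mul0r mulr0.
Qed.

End Cplus.

(** * The Riesz representation theorem *)

Definition positive_functional (R : realType) (T : topologicalType)
    (L : (T -> R) -> R) : Prop :=
  [/\ forall f, Cplus f -> 0 <= L f,
      forall f g, Cplus f -> Cplus g -> L (fun t => f t + g t) = L f + L g &
      forall a f, 0 <= a -> Cplus f -> L (fun t => a * f t) = a * L f].

Section PositiveFunctional.
Context {R : realType} {T : topologicalType}.
Variable L : (T -> R) -> R.
Hypothesis hL : positive_functional L.

Lemma positive_functional0 : L (fun=> 0) = 0.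
Proof.
case: hL => _ _ /(_ 0 (fun=> 0) (lexx _) Cplus0).
by under eq_fun do rewrite mul0r; rewrite mul0r.
Qed.

Lemma positive_functional_le f g : Cplus f -> Cplus g ->
  (forall t, f t <= g t) -> L f <= L g.
Proof.
move=> Cf Cg fg; case: hL => L0 LD _.
have Ch : Cplus (fun t => g t - f t).
  apply: (Cplus_le _ _ Cg); last first.
    by move=> t; rewrite subr_ge0 fg /= lerBlDr lerDl; case: Cf.
  move=> t; apply: cvgB; first by case: Cg => c _ _; exact: c.
  by case: Cf => c _ _; exact: c.
rewrite (_ : g = fun t => f t + (g t - f t)); last first.
  by apply/funext => t; rewrite addrC subrK.
by rewrite LD // lerDl L0.
Qed.

Lemma positive_functional_sum (I : Type) (s : seq I) (P : pred I) (f : I -> T -> R) :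
  (forall i, P i -> Cplus (f i)) ->
  L (fun t => \sum_(i <- s | P i) f i t) = \sum_(i <- s | P i) L (f i).
Proof.
move=> Cf; elim: s => [|i s IH].
  by under eq_fun do rewrite big_nil; rewrite big_nil positive_functional0.
under eq_fun do rewrite big_cons; rewrite big_cons; case Pi: (P i) => //.
by case: hL => _ -> //; [rewrite IH|exact: Cf|exact: Cplus_sum].
Qed.

End PositiveFunctional.

(** The layer of [f] between two consecutive heights, as in the layer-cake decomposition. *)
Definition slice (R : realType) (T : Type) (f : T -> R) (N j : nat) : T -> R :=
  fun t => Num.min (f t) (j.+1%:R / N%:R) - Num.min (f t) (j%:R / N%:R).

Section Sandwich.
Context {R : realType} {T : topologicalType}.
Variable mu : set T -> R.
Hypothesis mu_le : forall K K', compact K -> compact K' -> K `<=` K' -> mu K <= mu K'.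

Hypothesis mu_ge0 : forall K, compact K -> 0 <= mu K.

(** The inequalities [c 1_K <= f] and [f <= c 1_K], integrated. As [mu] is used on compact sets
    only, an abstract functional can be compared with a measure without any question of
    measurability. *)
Definition sandwiched (L : (T -> R) -> R) : Prop :=
  (forall K f c, compact K -> Cplus f -> 0 < c -> (forall t, K t -> c <= f t) ->
     c * mu K <= L f) /\
  (forall K f c, compact K -> Cplus f -> 0 < c -> (forall t, f t <= c) ->
     (forall t, ~ K t -> f t = 0) -> L f <= c * mu K).

Lemma slice_sum (f : T -> R) N : (0 < N)%N -> (forall t, 0 <= f t <= 1) ->
  forall t, f t = \sum_(0 <= j < N) slice f N j t.
Proof.
move=> N0 f01 t; rewrite /slice telescope_sumr // mul0r divff ?pnatr_eq0 -?lt0n //.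
have /andP[f0 f1] := f01 t.
by rewrite (min_idPl f1) (min_idPr f0) subr0.
Qed.

Lemma Cplus_slice (f : T -> R) N j : Cplus f -> Cplus (slice f N j).
Proof.
move=> Cf; case: (Cf) => cf f0 _; apply: Cplus_le Cf.
  have cm k : continuous (fun t => Num.min (f t) (k%:R / N%:R)).
    by apply: (@min_fun_continuous _ T R f (fun=> k%:R / N%:R)) => // t;
      exact: cst_continuous.
  by move=> t; apply: cvgB; exact: cm.
move=> t; rewrite /slice subr_ge0.
have jj : j%:R / N%:R <= j.+1%:R / N%:R :> R.
  by rewrite ler_wpM2r // ?invr_ge0 // ler_nat.
have f0t := f0 t; have j0 : 0 <= j%:R / N%:R :> R by rewrite divr_ge0.
by rewrite !minEle; case: ifP; case: ifP; lra.
Qed.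

(** The layer at level [j], times [N], lies between the indicators of [S N j.+1] and [S N j].
    Bounding the layers from above for [L] and from below for [J] leaves a telescoping sum, at most
    [mu C / N]. *)
Lemma sandwich_eq01 (L J : (T -> R) -> R) f :
  positive_functional L -> positive_functional J ->
  sandwiched L -> sandwiched J -> Cplus f -> (forall t, f t <= 1) -> L f <= J f.
Proof.
move=> hL hJ [LA LB] [JA JB] Cf f1.
have [cf f0 [C cC fC]] := Cf.
pose S N j := C `&` [set t | j%:R / N%:R <= f t].
have cS N j : compact (S N j).
  rewrite /S; apply: compact_closedI => //.
  exact: (preimage_closed (fun t _ => cf t) (@closed_ge _ (j%:R / N%:R))).
have key N : (0 < N)%N -> L f <= J f + mu C / N%:R.
  move=> N0; have N0R : 0 < N%:R^-1 :> R by rewrite invr_gt0 ltr0n.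
  have fE := slice_sum N0 (fun t => introT andP (conj (f0 t) (f1 t))).
  have LE : L f = \sum_(0 <= j < N) L (slice f N j).
    rewrite -(positive_functional_sum hL) => [|i _]; last exact: Cplus_slice.
    by congr L; apply/funext.
  have JE : J f = \sum_(0 <= j < N) J (slice f N j).
    rewrite -(positive_functional_sum hJ) => [|i _]; last exact: Cplus_slice.
    by congr J; apply/funext.
  have up j : L (slice f N j) <= N%:R^-1 * mu (S N j).
    apply: LB => //; first exact: Cplus_slice.
      move=> t; rewrite /slice -[j.+1]addn1 natrD mulrDl div1r.
      by rewrite !minEle; case: ifP; case: ifP; lra.
    move=> t nS; have [Ct|nC] := pselect (C t); last first.
      have j0 k : 0 <= k%:R / N%:R :> R by rewrite divr_ge0.
      by rewrite /slice fC // !(min_idPl _) // subrr.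
    have fj : f t < j%:R / N%:R by rewrite ltNge; apply/negP => ?; apply: nS.
    have jj : j%:R / N%:R <= j.+1%:R / N%:R :> R.
      by rewrite ler_wpM2r // ?invr_ge0 // ler_nat.
    by rewrite /slice !(min_idPl _) ?subrr // ?ltW // (lt_le_trans fj).
  have lo j : N%:R^-1 * mu (S N j.+1) <= J (slice f N j).
    apply: JA => //; first exact: Cplus_slice.
    move=> t [_ /= fj]; have jj : j%:R / N%:R <= j.+1%:R / N%:R :> R.
      by rewrite ler_wpM2r // ?invr_ge0 // ler_nat.
    rewrite /slice (min_idPr fj) (min_idPr _) ?(le_trans jj) //.
    by rewrite -mulrBl -natrB ?subSnn ?div1r.
  have : L f - J f <= \sum_(0 <= j < N) (N%:R^-1 * mu (S N j) - N%:R^-1 * mu (S N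
    j.+1)).
    rewrite LE JE -sumrB; apply: ler_sum => j _.
    by apply: lerB.
  rewrite lerBlDl => /le_trans; apply; rewrite lerD2l.
  under eq_bigr do rewrite -opprB; rewrite sumrN telescope_sumr // opprB.
  have mS0 : mu (S N 0%N) <= mu C by apply: mu_le => // t [].
  have mSN : 0 <= mu (S N N) by exact: mu_ge0.
  by rewrite -mulrBr mulrC ler_pM2r // lerBlDr (le_trans mS0) // lerDl.
suff : forall e, 0 < e -> L f <= J f + e by move=> H; apply/ler_addgt0Pr.
move=> e e0; have muC := mu_ge0 cC.
have [N Ne] : exists N : nat, mu C / e < N%:R.
  by exists (Num.truncn (mu C / e)).+1; exact: truncnS_gt.
have N0 : 0 < N%:R :> R by rewrite (le_lt_trans _ Ne) // divr_ge0 // ltW.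
apply: (le_trans (key N _)); first by rewrite ltr0n in N0.
by rewrite lerD2l ler_pdivrMr // mulrC -ler_pdivrMr // ltW.
Qed.

Lemma sandwich_eq (L J : (T -> R) -> R) f :
  positive_functional L -> positive_functional J ->
  sandwiched L -> sandwiched J -> Cplus f -> L f = J f.
Proof.
move=> hL hJ sL sJ Cf; have [M M0 fM] := Cplus_bounded Cf.
have CfM : Cplus (fun t => M^-1 * f t) by apply: CplusZ => //; rewrite invr_ge0 ltW.
have fM1 t : M^-1 * f t <= 1 by rewrite mulrC ler_pdivrMr // mul1r.
have fE : f = fun t => M * (M^-1 * f t).
  by apply/funext => t; rewrite mulVKf // gt_eqF.
case: (hL) (hJ) => [_ _ LZ] [_ _ JZ].
rewrite fE LZ ?(ltW M0) // JZ ?(ltW M0) //; congr (_ * _).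
by apply: le_anti; rewrite !sandwich_eq01.
Qed.

End Sandwich.

Lemma continuous_borel_measurable (R : realType) (T : ptopologicalType) (f : T -> R) :
  continuous f -> measurable_fun (setT : set (borel T)) (f : borel T -> R).
Proof.
move=> /continuousP cf; apply: (measurability _ (RGenOpens.measurableE R)).
move=> _ [_ [a [b ->] <-]]; rewrite setTI.
by apply: sub_sigma_algebra; apply: cf; exact: interval_open.
Qed.

Lemma open_borel (T : ptopologicalType) (U : set T) :
  open U -> measurable (U : set (borel T)).
Proof. by move=> oU; exact: sub_sigma_algebra. Qed.

Lemma closed_borel (T : ptopologicalType) (U : set T) :
  closed U -> measurable (U : set (borel T)).
Proof.
by move=> cU; rewrite -[U]setCK; apply: measurableC; apply: open_borel;
  exact: closed_openC.
Qed.

Section CplusIntegral.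
Context {R : realType} {T : ptopologicalType}.
Hypothesis hT : hausdorff_space T.
Variable mu : {measure set (borel T) -> \bar R}.
Hypothesis mu_fin : forall K : set T, compact K -> (mu K < +oo)%E.
Local Open Scope ereal_scope.

Lemma compact_borel (K : set T) : compact K -> measurable (K : set (borel T)).
Proof. by move=> cK; apply: closed_borel; exact: compact_closed. Qed.

Lemma Cplus_measurable (f : T -> R) : Cplus f ->
  measurable_fun (setT : set (borel T)) ((fun t => (f t)%:E) : borel T -> \bar R).
Proof.
by move=> [cf _ _]; apply/measurable_EFinP; exact: continuous_borel_measurable.
Qed.

Lemma integral_Cplus_le (f : T -> R) (K : set T) (c : R) : Cplus f ->
  compact K -> (0 <= c)%R -> (forall t, f t <= c)%R -> (forall t, ~ K t -> f t = 0%R) ->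
  \int[mu]_t (f t)%:E <= c%:E * mu K.
Proof.
move=> Cf cK c0 fc fK; have mK := compact_borel cK.
have -> : c%:E * mu K = \int[mu]_t (c%:E * (\1_(K : set (borel T)) t)%:E).
  rewrite ge0_integralZl // ?integral_indic ?setIT //.
  by apply/measurable_EFinP; exact: measurable_indic.
apply: ge0_le_integral => //.
- by move=> t _; rewrite lee_fin; case: Cf.
- exact: Cplus_measurable.
- apply: measurable_funeM; apply/measurable_EFinP; exact: measurable_indic.
- move=> t _; rewrite -EFinM lee_fin indicE.
  have [Kt|nK] := pselect (K t); first by rewrite mem_set // mulr1.
  by rewrite fK // memNset // mulr0.
Qed.

Lemma integral_Cplus_ge (f : T -> R) (K : set T) (c : R) : Cplus f ->
  measurable (K : set (borel T)) -> (0 <= c)%R -> (forall t, K t -> c <= f t)%R ->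
  c%:E * mu K <= \int[mu]_t (f t)%:E.
Proof.
move=> Cf mK c0 fc.
have -> : c%:E * mu K = \int[mu]_t (c%:E * (\1_(K : set (borel T)) t)%:E).
  rewrite ge0_integralZl // ?integral_indic ?setIT //.
  by apply/measurable_EFinP; exact: measurable_indic.
apply: ge0_le_integral => //.
- by move=> t _; rewrite -EFinM lee_fin mulr_ge0.
- apply: measurable_funeM; apply/measurable_EFinP; exact: measurable_indic.
- exact: Cplus_measurable.
- move=> t _; rewrite -EFinM lee_fin indicE.
  have [Kt|nK] := pselect (K t); first by rewrite mem_set // mulr1 fc.
  by rewrite memNset // mulr0; case: Cf.
Qed.

Lemma integral_Cplus_fin (f : T -> R) : Cplus f -> \int[mu]_t (f t)%:E \is a fin_num.
Proof.
move=> Cf; have [_ f0 [K cK fK]] := Cf; have [M M0 fM] := Cplus_bounded Cf.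
rewrite ge0_fin_numE; last by apply: integral_ge0 => t _; rewrite lee_fin.
apply: (le_lt_trans (integral_Cplus_le Cf cK (ltW M0) fM fK)).
by rewrite lte_mul_pinfty ?lee_fin ?(ltW M0) // mu_fin.
Qed.

Lemma positive_functional_integral :
  positive_functional (fun f : T -> R => fine (\int[mu]_t (f t)%:E)).
Proof.
split.
- by move=> f [_ f0 _]; apply: fine_ge0; apply: integral_ge0 => t _; rewrite lee_fin.
- move=> f g Cf Cg; rewrite -fineD ?integral_Cplus_fin //; congr fine.
  under eq_integral do rewrite EFinD.
  rewrite ge0_integralD //; try exact: Cplus_measurable.
    by move=> t _; rewrite lee_fin; case: Cf.
  by move=> t _; rewrite lee_fin; case: Cg.
- move=> a f a0 Cf.
  under eq_integral do rewrite EFinM.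
  rewrite ge0_integralZl ?lee_fin //; first by rewrite fineM ?integral_Cplus_fin.
    exact: Cplus_measurable.
  by move=> t _; rewrite lee_fin; case: Cf.
Qed.

Lemma sandwiched_integral : sandwiched (fun K => fine (mu K))
  (fun f : T -> R => fine (\int[mu]_t (f t)%:E)).
Proof.
split=> K f c cK Cf c0 fc;
  have fK : mu K \is a fin_num by rewrite ge0_fin_numE // mu_fin.
  rewrite -lee_fin EFinM !fineK ?integral_Cplus_fin //.
  apply: integral_Cplus_ge => //; [exact: compact_borel|exact: ltW].
move=> f0; rewrite -lee_fin EFinM !fineK ?integral_Cplus_fin //.
by apply: integral_Cplus_le => //; exact: ltW.
Qed.

End CplusIntegral.

(** * The outer measure of a positive functional *)

Section Riesz.
Context {R : realType} {T : ptopologicalType}.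
Hypothesis lT : lch_space T.
Variable L : (T -> R) -> R.
Hypothesis hL : positive_functional L.
Local Open Scope ereal_scope.

Definition dominated_by (U : set T) (f : T -> R) : Prop :=
  [/\ Cplus f, forall t, (f t <= 1)%R &
      exists2 C, compact C & C `<=` U /\ forall t, ~ C t -> f t = 0%R].

Lemma dominated_by0 U : dominated_by U (fun=> 0%R).
Proof.
split; [exact: Cplus0|by move=> ?; exact: ler01|].
by exists set0; [exact: compact0|split].
Qed.

Definition riesz_open (U : set T) : \bar R :=
  ereal_sup [set (L f)%:E | f in dominated_by U].

Definition riesz (E : set T) : \bar R :=
  ereal_inf [set riesz_open U | U in [set U : set T | open U /\ E `<=` U]].

Lemma riesz_open_ge0 U : 0 <= riesz_open U.
Proof.
apply: ereal_sup_ubound; exists (fun=> 0%R); first exact: dominated_by0.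
by rewrite (positive_functional0 hL).
Qed.

Lemma riesz_open_le U V : U `<=` V -> riesz_open U <= riesz_open V.
Proof.
move=> UV; apply: ereal_sup_le => _ [f [Cf f1 [C cC [CU fC]]] <-].
exists f => //; split => //; exists C => //; split => //.
exact: subset_trans UV.
Qed.

Lemma rieszE U : open U -> riesz U = riesz_open U.
Proof.
move=> oU; apply/eqP; rewrite eq_le; apply/andP; split.
  by apply: ereal_inf_lbound; exists U => //; split => //; exact: subset_refl.
by apply: le_ereal_inf_tmp => _ [V [oV UV] <-]; exact: riesz_open_le.
Qed.

Lemma riesz_ge0 E : 0 <= riesz E.
Proof. by apply: le_ereal_inf_tmp => _ [V _ <-]; exact: riesz_open_ge0. Qed.

Lemma riesz_le E F : E `<=` F -> riesz E <= riesz F.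
Proof.
move=> EF; apply: ereal_inf_le_tmp => _ [V [oV FV] <-].
by exists V => //; split => //; exact: subset_trans FV.
Qed.

Lemma riesz0 : riesz set0 = 0.
Proof.
rewrite rieszE; last exact: open0.
apply/eqP; rewrite eq_le; apply/andP; split; last exact: riesz_open_ge0.
apply: ge_ereal_sup => _ [f [Cf f1 [C cC [C0 fC]]] <-].
rewrite (_ : f = fun=> 0%R) ?(positive_functional0 hL) //.
by apply/funext => t; apply: fC => /C0.
Qed.

(** A function dominated by the union is partitioned along neighbourhoods equal to [U] or to [V],
    and its pieces are regrouped into two sums, one for each set. *)
Lemma riesz_openU U V : open U -> open V ->
  riesz_open (U `|` V) <= riesz_open U + riesz_open V.
Proof.
move=> oU oV; apply: ge_ereal_sup => _ [f [Cf f1 [C cC [CU fC]]] <-].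
(* Points of both sets are assigned to [U], so that each centre belongs to exactly one of the two
   sums. *)
pose W t := if `[< U t >] then U else V.
have CW t : C t -> nbhs t (W t).
  move=> Ct; rewrite /W; case: asboolP => Ut; apply: open_nbhs_nbhs; split => //.
  by have [] := CU _ Ct.
have [s [h [sC sh fE]]] := Cplus_decomp lT Cf cC fC CW.
pose g (b : bool) t := (\sum_(u <- s | (u \in s) && (`[< U u >] == b)) h u t)%R.
have Cg b : Cplus (g b) by apply: Cplus_sum => u /andP[/sh[]].
have g0 b t : (0 <= g b t)%R by case: (Cg b).
have fg t : f t = (g true t + g false t)%R.
  rewrite fE /g big_seq_cond (bigID (fun u => `[< U u >])) /=.
  congr (_ + _)%R; apply: eq_bigl => u; rewrite andbT ?eqb_id //.
  by rewrite eqbF_neg.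
have Dg b : dominated_by (if b then U else V) (g b).
  split => //.
    move=> t; apply: le_trans (f1 t); rewrite fg.
    by case: b; rewrite ?lerDl ?lerDr.
  have /choice[D HD] : forall u, exists D, u \in s -> compact D /\
      (D `<=` W u /\ forall t, ~ D t -> h u t = 0%R).
    move=> u; have [us|] := boolP (u \in s); last by exists set0.
    by have [_ _ [D ? ?]] := sh _ us; exists D.
  pose s' := [seq u <- s | (u \in s) && (`[< U u >] == b)].
  exists (\big[setU/set0]_(u <- s') D u).
    rewrite big_filter; apply: bigsetU_compact => u /andP[us _].
    exact: (HD u us).1.
  rewrite -bigcup_seq; split.
    move=> t [u /=]; rewrite mem_filter => /andP[/andP[us /eqP <-] _].
    by move/((HD u us).2.1); rewrite /W.
  move=> t nD; rewrite /g big_seq_cond big1 // => u /andP[us /andP[_ ub]].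
  apply: (HD u us).2.2 => Du; apply: nD; exists u => //=.
  by rewrite mem_filter us ub.
have -> : L f = (L (g true) + L (g false))%R.
  have [_ <- // _] := hL; by congr L; apply/funext.
rewrite EFinD; apply: leeD; apply: ereal_sup_ubound.
  by exists (g true) => //; exact: (Dg true).
by exists (g false) => //; exact: (Dg false).
Qed.

(** The compact support of a competitor already lies in finitely many of the [U n], so finite
    subadditivity suffices. *)
Lemma riesz_open_bigcup (U : nat -> set T) : (forall n, open (U n)) ->
  riesz_open (\bigcup_n U n) <= \sum_(0 <= n <oo) riesz_open (U n).
Proof.
move=> oU; apply: ge_ereal_sup => _ [f [Cf f1 [C cC [CU fC]]] <-].
pose V N := \big[setU/set0]_(0 <= n < N) U n.
have oV N : open (V N).
  by rewrite /V big_mkord -bigcup_mkord; apply: bigcup_open.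
have VS N : riesz_open (V N) <= \sum_(0 <= n < N) riesz_open (U n).
  elim: N => [|N IH].
    rewrite /V !big_nil -rieszE ?riesz0 //; exact: open0.
  rewrite /V !big_nat_recr //=; apply: (le_trans (riesz_openU (oV N) (oU N))).
  exact: leeD2r.
have /compact_near_coveringP/(_ _ \oo (fun N t => V N t)) := cC.
case=> [|N _ /(_ N (leqnn N)) CV].
  move=> t /CU[n _ Unt]; exists (U n, [set N | (n < N)%N]).
    split; first by apply: open_nbhs_nbhs; split; [exact: oU|exact: Unt].
    by exists n.+1.
  move=> [x N] /= [Ux nN]; rewrite /V big_mkord -bigcup_mkord; exists n => //.
apply: (@le_trans _ _ (riesz_open (V N))).
  by apply: ereal_sup_ubound; exists f => //; split => //; exists C.
apply: (le_trans (VS N)); apply: nneseries_lim_ge => n _ _.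
exact: riesz_open_ge0.
Qed.

Lemma riesz_sigma_subadditive : sigma_subadditive riesz.
Proof.
move=> A; have [[i ioo]|] := pselect (exists i, riesz (A i) = +oo).
  rewrite (eseries_pinfty _ _ ioo) ?leey// => n _.
  by rewrite -ltNye (lt_le_trans _ (riesz_ge0 _)).
rewrite -forallNE => Aoo; apply/lee_addgt0Pr => e e0.
rewrite (le_trans _ (epsilon_trick _ _ (ltW e0)))//; last first.
  by move=> n; exact: riesz_ge0.
have /choice[U HU] : forall n, exists U : set T, [/\ open U, A n `<=` U &
    riesz_open U <= riesz (A n) + (e / (2 ^ n.+1)%:R)%:E].
  move=> n; have fA : riesz (A n) \is a fin_num.
    by rewrite ge0_fin_numE ?riesz_ge0 // ltey; apply/eqP.
  have en : (0 < e / (2 ^ n.+1)%:R)%R by rewrite divr_gt0 // ltr0n expn_gt0.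
  have [_ [U [oU AU] <-] /ltW le] := lb_ereal_inf_adherent en fA.
  by exists U; split => //; exact: le.
apply: (@le_trans _ _ (riesz (\bigcup_n U n))).
  apply: riesz_le => t [n _ At]; exists n => //; case: (HU n) => _ + _; exact.
rewrite rieszE; last by apply: bigcup_open => n _; case: (HU n).
apply: (le_trans (riesz_open_bigcup _)) => [n|]; first by case: (HU n).
apply: lee_nneseries => n _; first by move=> _; exact: riesz_open_ge0.
by have [_ _ h] := HU n; exact: h.
Qed.

HB.instance Definition _ := isOuterMeasure.Build R T riesz
  riesz0 riesz_ge0 riesz_le riesz_sigma_subadditive.

Lemma open_caratheodory (U : set T) : open U -> riesz.-caratheodory U.
Proof.
move=> oU; apply: le_caratheodory_measurable => X.
apply: le_ereal_inf_tmp => _ [V [oV XV] <-].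
apply: (@le_trans _ _ (riesz_open (V `&` U) + riesz (V `&` ~` U))).
  rewrite -rieszE; last exact: openI.
  by apply: leeD; apply: riesz_le; exact: setSI.
(* Once [f] is fixed, vanishing off [C], any [g] dominated by [V] minus [C] vanishes on [C]; hence
   [g + f] is still bounded by 1 and dominated by [V]. *)
have key f : dominated_by (V `&` U) f ->
    (L f)%:E + riesz (V `&` ~` U) <= riesz_open V.
  move=> [Cf f1 [C cC [CVU fC]]].
  have clC : closed C by exact: compact_closed lT.2 cC.
  have oVC : open (V `&` ~` C) by apply: openI => //; exact: closed_openC.
  apply: (@le_trans _ _ ((L f)%:E + riesz_open (V `&` ~` C))).
    rewrite leeD2l // -rieszE //; apply: riesz_le.
    by move=> t [Vt nUt]; split => // /CVU[].
  rewrite addeC -leeBrDr //; apply: ge_ereal_sup => _ [g [Cg g1 [D cD [DV gD]]] <-].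
  rewrite leeBrDr // -EFinD; apply: ereal_sup_ubound.
  exists (fun t => g t + f t)%R; last by have [_ -> // _] := hL.
  split; first exact: CplusD.
    move=> t; have [Ct|nC] := pselect (C t).
      by rewrite gD ?add0r // => /DV[].
    by rewrite fC // addr0.
  exists (C `|` D); first exact: compactU.
  split; first by move=> t [/CVU[]|/DV[]].
  by move=> t /not_orP[nC nD]; rewrite gD // fC // addr0.
have [roo|rfin] := eqVneq (riesz (V `&` ~` U)) +oo.
  have := key _ (dominated_by0 _); rewrite roo addey // => /(le_trans _)->//.
  exact: leey.
have fr : riesz (V `&` ~` U) \is a fin_num.
  by rewrite ge0_fin_numE ?riesz_ge0 // ltey.
rewrite -leeBrDr //; apply: ge_ereal_sup => _ [f Df <-].
by rewrite leeBrDr //; exact: key.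
Qed.

Lemma borel_caratheodory (A : set T) :
  measurable (A : set (borel T)) -> riesz.-caratheodory A.
Proof.
move=> mA; have : (riesz.-cara).-measurable (A : set (caratheodory_type riesz)).
  apply: (smallest_sub _ _ mA); first exact: sigma_algebra_measurable.
  exact: open_caratheodory.
by [].
Qed.

Definition riesz_measure : set (borel T) -> \bar R := riesz.

Let riesz_measure_sigma_additive : semi_sigma_additive riesz_measure.
Proof.
move=> A mA tA mbA.
apply: (@caratheodory_measure_sigma_additive _ _ riesz A _ tA).
  by move=> n; apply: borel_caratheodory; exact: mA.
exact: borel_caratheodory.
Qed.

HB.instance Definition _ := isMeasure.Build _ (borel T) R riesz_measure
  riesz0 riesz_ge0 riesz_measure_sigma_additive.

Lemma riesz_lower (K : set T) f c : compact K -> Cplus f -> (0 < c)%R ->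
  (forall t, K t -> c <= f t)%R -> c%:E * riesz K <= (L f)%:E.
Proof.
move=> cK Cf c0 fc; have [cf f0 _] := Cf.
(* An open set containing [K] is needed, so the threshold is lowered to [d < c]; the bound for [c]
   follows by letting [d] tend to [c]. *)
have key d : (0 < d < c)%R -> d%:E * riesz K <= (L f)%:E.
  move=> /andP[d0 dc].
  pose U := [set t | (d < f t)%R].
  have oU : open U by exact: (@open_comp _ _ f [set r | (d < r)%R] (fun t _ => cf t)
    (@open_gt _ d)).
  have KU : K `<=` U by move=> t /fc; exact: lt_le_trans.
  rewrite -lee_pdivlMl //; apply: (@le_trans _ _ (riesz_open U)).
    by rewrite -rieszE //; exact: riesz_le.
  apply: ge_ereal_sup => _ [g [Cg g1 [C cC [CU gC]]] <-].
  rewrite -EFinM lee_fin ler_pdivlMl //.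
  have [_ _ <- //] := hL; last exact: ltW.
  apply: (positive_functional_le hL) => //; first by apply: CplusZ => //; exact: ltW.
  move=> t; have [/CU Ut|nC] := pselect (C t); last by rewrite gC // mulr0.
  by rewrite (le_trans _ (ltW Ut)) // ler_piMr // ltW.
have c2 : (0 < c / 2 < c)%R by rewrite divr_gt0 //= ltr_pdivrMr // ltr_pMr // ltr1n.
have fK : riesz K \is a fin_num.
  rewrite ge0_fin_numE ?riesz_ge0 //;
    apply: (@le_lt_trans _ _ ((c / 2)^-1%:E * (L f)%:E)).
    by rewrite lee_pdivlMl ?key //; case/andP: c2.
  by rewrite -EFinM ltry.
rewrite -(fineK fK) -EFinM lee_fin; apply/ler_addgt0Pr => e e0.
have m0 : (0 <= fine (riesz K))%R by rewrite fine_ge0 // riesz_ge0.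
(* [c - d] is at most [e / (m + 1)], so [(c - d) * m <= e] even when [m = 0]; the cap [c / 2] keeps
   [d] positive. *)
pose m := fine (riesz K); pose d := (c - Num.min (c / 2) (e / (m + 1)))%R.
have mp : (0 < m + 1)%R by rewrite ltr_wpDl.
have d0c : (0 < d < c)%R.
  rewrite /d subr_gt0 gt_min; case/andP: c2 => c20 -> /=.
  by rewrite ltrBlDr ltrDl lt_min c20 divr_gt0.
have := key _ d0c; rewrite -(fineK fK) -EFinM lee_fin -/m => dm.
have : (c * m - d * m <= e)%R.
  rewrite -mulrBl /d opprB addrC subrK.
  apply: (@le_trans _ _ (e / (m + 1) * m)%R);
    first by rewrite ler_wpM2r // ge_min lexx orbT.
  by rewrite mulrAC ler_pdivrMr // ler_pM2l // lerDl.
by rewrite lerBlDl => /le_trans; apply; rewrite lerD2r.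
Qed.

Lemma riesz_compact (K : set T) : compact K -> riesz K < +oo.
Proof.
move=> cK; have [f [Cf _ f1 _]] := @lch_bump R T K setT lT cK openT (fun _ _ => I).
apply: (le_lt_trans _ (ltry (L f))); rewrite -[riesz K]mul1e.
by apply: riesz_lower => // t /f1 ->.
Qed.

Lemma riesz_upper (K : set T) f c : compact K -> Cplus f -> (0 < c)%R ->
  (forall t, f t <= c)%R -> (forall t, ~ K t -> f t = 0)%R ->
  (L f)%:E <= c%:E * riesz K.
Proof.
move=> cK Cf c0 fc fK; rewrite -lee_pdivrMl //.
apply: le_ereal_inf_tmp => _ [V [oV KV] <-]; apply: ereal_sup_ubound.
exists (fun t => c^-1 * f t)%R; last by have [_ _ ->] := hL => //; rewrite invr_ge0 ltW.
split; first by apply: CplusZ => //; rewrite invr_ge0 ltW.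
  by move=> t; rewrite ler_pdivrMl // mulr1.
by exists K => //; split => // t /fK ->; rewrite mulr0.
Qed.

Lemma riesz_radon : radon_measure riesz_measure.
Proof.
split.
- exact: riesz_compact.
- move=> E mE; apply/eqP; rewrite eq_le; apply/andP; split.
    by apply: le_ereal_inf_tmp => _ [U [oU EU] <-]; exact: riesz_le.
  apply: le_ereal_inf_tmp => _ [U [oU EU] <-]; apply: ereal_inf_lbound.
  by exists U => //; exact: rieszE.
- move=> U oU; apply/eqP; rewrite eq_le; apply/andP; split; last first.
    by apply: ge_ereal_sup => _ [K [cK KU] <-]; exact: riesz_le.
  apply: (@le_trans _ _ (riesz_open U)); first by rewrite -rieszE.
  apply: ge_ereal_sup => _ [f [Cf f1 [C cC [CU fC]]] <-].
  apply: (@le_trans _ _ (riesz C)).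
    by rewrite -[riesz C]mul1e; exact: riesz_upper.
  by apply: ereal_sup_ubound; exists C.
Qed.

(** The functional and the integral against [riesz_measure] are sandwiched by the same values on
    compact sets, so [sandwich_eq] identifies them. *)
Lemma riesz_representation : exists mu : {measure set (borel T) -> \bar R},
  radon_measure mu /\ forall f, Cplus f -> \int[mu]_t (f t)%:E = (L f)%:E.
Proof.
exists riesz_measure; split; first exact: riesz_radon.
move=> f Cf; have hT := lT.2; have mf := riesz_compact.
rewrite -(fineK (integral_Cplus_fin hT (mu := riesz_measure) mf Cf)); congr EFin.
apply/esym; apply: (sandwich_eq (mu := fun K => fine (riesz K))
  (J := fun g => fine (\int[riesz_measure]_t (g t)%:E)) _ _ hL _ _ _ Cf).
- move=> K K' cK cK' KK'; apply: fine_le; last exact: riesz_le.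
    by rewrite ge0_fin_numE ?riesz_ge0 ?mf.
  by rewrite ge0_fin_numE ?riesz_ge0 ?mf.
- by move=> K cK; rewrite fine_ge0 // riesz_ge0.
- exact: (positive_functional_integral (mu := riesz_measure) hT mf).
- split=> K g c cK Cg c0 gc;
  have fK : riesz K \is a fin_num by rewrite ge0_fin_numE ?riesz_ge0 ?mf.
    by rewrite -lee_fin EFinM fineK //; exact: riesz_lower.
  by move=> g0; rewrite -lee_fin EFinM fineK //; exact: riesz_upper.
- exact: (sandwiched_integral (mu := riesz_measure) hT mf).
Qed.

End Riesz.

(** * Haar functionals on locally compact groups *)

Definition is_lc_group (H : topologicalType) (mul : H -> H -> H) (one : H)
    (inv : H -> H) : Prop :=
  [/\ lch_space H,
      [/\ associative mul, left_id one mul & left_inverse one inv mul],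
      continuous (fun p : H * H => mul p.1 p.2) & continuous inv].

Definition left_invariant (R : realType) (H : topologicalType) (mul : H -> H -> H)
    (L : (H -> R) -> R) : Prop :=
  forall s f, Cplus f -> L (fun t => f (mul s t)) = L f.

Definition strictly_positive (R : realType) (H : topologicalType)
    (L : (H -> R) -> R) : Prop :=
  forall f, Cplus f -> (exists t, 0 < f t) -> 0 < L f.

Lemma ultra_bounded_cvg (R : realType) (I : Type) (F : set_system I) (g : I -> R) (M :
  R) :
  UltraFilter F -> F [set i | 0 <= g i <= M] -> exists l : R, g @ F --> l.
Proof.
move=> UF FM; have PF : ProperFilter F by exact: ultra_proper.
have [|l [_ Gl]] := @segment_compact R 0 M (g @ F) _.
  change (F (g @^-1` `[0, M])); apply: filterS FM => i gi.
  by rewrite /= in_itv.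
exists l => A lA; have [//|FnA] := in_ultra_setVsetC (g @^-1` A) UF.
by have [x [nAx Ax]] := Gl (~` A) A FnA lA.
Qed.

Lemma filter_cvg_le (R : realType) (I : Type) (F : set_system I) (f g : I -> R) (l k :
  R) :
  ProperFilter F -> f @ F --> l -> g @ F --> k -> F [set i | f i <= g i] -> l <= k.
Proof.
move=> PF fl gk fg; rewrite -subr_ge0.
have h : (g \- f) i @[i --> F] --> k - l by exact: cvgB.
rewrite -(cvg_lim _ h) //; apply: limr_ge; first by apply/cvg_ex; exists (k - l).
by apply: filterS fg => i /=; rewrite subr_ge0.
Qed.

Lemma filter_cvg_eq (R : realType) (I : Type) (F : set_system I) (f g : I -> R) (l k :
  R) :
  ProperFilter F -> f @ F --> l -> g @ F --> k -> F [set i | f i = g i] -> l = k.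
Proof.
move=> PF fl gk fg; apply: le_anti; apply/andP; split.
  by apply: (filter_cvg_le PF fl gk); apply: filterS fg => i /= ->.
by apply: (filter_cvg_le PF gk fl); apply: filterS fg => i /= ->.
Qed.

Section Group.
Context {R : realType} {H : topologicalType}.
Variables (mul : H -> H -> H) (one : H) (inv : H -> H).
Hypothesis gH : is_lc_group mul one inv.

Let lH : lch_space H. Proof. by case: gH. Qed.
Let mulA a b c : mul a (mul b c) = mul (mul a b) c.
Proof. by case: gH => _ [+ _ _] _ _; exact. Qed.
Let mul1 a : mul one a = a. Proof. by case: gH => _ [_ + _] _ _; exact. Qed.
Let mulV a : mul (inv a) a = one. Proof. by case: gH => _ [_ _ +] _ _; exact. Qed.
Let mulK a b : mul (inv a) (mul a b) = b. Proof. by rewrite mulA mulV mul1. Qed.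
Let mulVr a : mul a (inv a) = one.
Proof.
rewrite -[LHS]mul1 -{1}(mulV (inv a)) -mulA [X in mul _ X]mulA mulV mul1.
exact: mulV.
Qed.
Let mul1r a : mul a one = a. Proof. by rewrite -(mulV a) mulA mulVr mul1. Qed.
Let mulKV a b : mul a (mul (inv a) b) = b. Proof. by rewrite mulA mulVr mul1. Qed.
Let invK a : inv (inv a) = a.
Proof. by rewrite -[LHS]mul1r -(mulV a) mulA mulV mul1. Qed.
Let inv1 : inv one = one. Proof. by rewrite -[LHS]mul1r mulV. Qed.
Let invM a b : inv (mul a b) = mul (inv b) (inv a).
Proof.
rewrite -[RHS]mul1r -(mulVr (mul a b)); set c := inv (mul a b).
by rewrite -!mulA mulK mulK.
Qed.
Let mulC : continuous (fun p : H * H => mul p.1 p.2). Proof. by case: gH. Qed.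
Let invC : continuous inv. Proof. by case: gH. Qed.

Lemma continuous_mull s : continuous (mul s).
Proof.
move=> t; apply: (@continuous_comp H (H * H)%type H (fun z => (s, z))
  (fun p => mul p.1 p.2)); last exact: mulC.
by apply: cvg_pair; [exact: cvg_cst|exact: cvg_id].
Qed.

Lemma Cplus_shift (f : H -> R) s : Cplus f -> Cplus (fun t => f (mul s t)).
Proof.
move=> [cf f0 [K cK fK]]; split => //.
  by move=> t; apply: continuous_comp; [exact: continuous_mull|exact: cf].
exists (mul (inv s) @` K).
  by apply: continuous_compact cK; apply: continuous_subspaceT; exact: continuous_mull.
by move=> t nK; apply: fK => Kst; apply: nK; exists (mul s t) => //; rewrite mulK.
Qed.

Lemma Cplus_inv (f : H -> R) : Cplus f -> Cplus (fun t => f (inv t)).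
Proof.
move=> [cf f0 [K cK fK]]; split => //.
  by move=> t; apply: continuous_comp; [exact: invC|exact: cf].
exists (inv @` K).
  by apply: continuous_compact cK; apply: continuous_subspaceT; exact: invC.
by move=> t nK; apply: fK => Kst; apply: nK; exists (inv t).
Qed.

(** Compactness gives the estimate for [t] in [K]. When only [mul t v] lies in [K], it is used at
    [mul t v] with [inv v], whence the intersection with the inverse of the first neighbourhood. *)
Lemma left_uniform (f : H -> R) e : Cplus f -> 0 < e ->
  nbhs one [set v | forall t, `|f (mul t v) - f t| <= e].
Proof.
move=> [cf f0 [K cK fK]] e0.
have : \forall v \near one, K `<=` (fun t => `|f (mul t v) - f t| <= e).
  move/compact_near_coveringP : cK => /(_ _ (nbhs one)
    (fun v t => `|f (mul t v) - f t| <= e)); apply => t Kt.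
  have c1 : f (mul p.1 p.2) @[p --> (t, one)] --> f t.
    apply: continuous_cvg; first by exact: cf.
    by have := @mulC (t, one); rewrite /continuous_at /= mul1r.
  have c2 : f p.1 @[p --> (t, one)] --> f t.
    by apply: continuous_cvg; [exact: cf|exact: cvg_fst].
  have e2 : 0 < e / 2 by rewrite divr_gt0.
  move/cvgrPdist_lt : c1 => /(_ _ e2) c1; move/cvgrPdist_lt : c2 => /(_ _ e2) c2.
  have [[A B] /= [tA oB] AB] := filterI c1 c2.
  exists (A, B) => // -[x v] /= xv; have [/= h1 h2] := AB (x, v) xv.
  rewrite -[_ - _](subrKA (f t)) [e]splitr (le_trans (ler_normD _ _)) //.
  by rewrite lerD // ltW // distrC.
move=> V1; have V2 : nbhs one (inv @^-1` [set v | K `<=` (fun t => `|f (mul t v) - f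
  t| <= e)]).
  by have := @invC one; rewrite /continuous_at inv1 => /(_ _ V1).
apply: filterS (filterI V1 V2) => v [/= h1 h2] t.
have [Kt|nKt] := pselect (K t); first exact: h1.
have [Kv|nKv] := pselect (K (mul t v)); last by rewrite !fK // subrr normr0 ltW.
by have := h2 _ Kv; rewrite -mulA mulVr mul1r distrC.
Qed.

Lemma right_uniform (f : H -> R) e : Cplus f -> 0 < e ->
  nbhs one [set v | forall t, `|f (mul (inv v) t) - f t| <= e].
Proof.
move=> Cf e0; have := left_uniform (Cplus_inv Cf) e0; apply: filterS => v /= h t.
by have := h (inv t); rewrite invM !invK.
Qed.

(** * Covering numbers and the existence of Haar functionals *)

Definition covers (f phi : H -> R) (l : seq (R * H)) : Prop :=
  all (fun p => 0 <= p.1) l /\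
  forall t, f t <= \sum_(p <- l) p.1 * phi (mul (inv p.2) t).

(* Haar's covering number [(f : phi)]. *)
Definition cov (f phi : H -> R) : R :=
  inf [set \sum_(p <- l) p.1 | l in covers f phi].

Let sum_ge0 (l : seq (R * H)) : all (fun p => 0 <= p.1) l -> 0 <= \sum_(p <- l) p.1.
Proof.
move=> /allP l0; rewrite big_seq_cond; apply: sumr_ge0 => p; rewrite andbT.
exact: l0.
Qed.

Lemma cov_le f phi l : covers f phi l -> cov f phi <= \sum_(p <- l) p.1.
Proof.
move=> lc; apply: ge_inf; last by exists l.
by exists 0 => _ [l' [l0 _] <-]; exact: sum_ge0.
Qed.

Definition bump (phi : H -> R) : Prop := Cplus phi /\ exists t, 0 < phi t.

Lemma covers_exists f phi : Cplus f -> bump phi -> exists l, covers f phi l.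
Proof.
move=> Cf [[cp p0 _] [t0 pt0]]; have [cf f0 [K cK fK]] := Cf.
have [M M0 fM] := Cplus_bounded Cf.
(* Left translation by [t0 s^-1] takes [s] to [t0], so [U s] is a neighbourhood of [s]; the
   coefficient [c] below raises the lower bound [phi t0 / 2] to the bound [M] of [f]. *)
pose U (s : H) := [set t | phi t0 / 2 < phi (mul (mul t0 (inv s)) t)].
have [|s [sK Ks]] := compact_finite_cover (U := U) cK.
  move=> t _; have /(_ t) ct : continuous (fun z => phi (mul (mul t0 (inv t)) z)).
    by move=> z; apply: continuous_comp; [exact: continuous_mull|exact: cp].
  apply: (ct [set r | phi t0 / 2 < r]); apply: lt_nbhsr.
  by rewrite -mulA mulV mul1r ltr_pdivrMr // ltr_pMr // ltr1n.
pose c := M / (phi t0 / 2).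
have c0 : 0 <= c by rewrite divr_ge0 ?divr_ge0 // ltW.
exists [seq (c, inv (mul t0 (inv u))) | u <- s]; split.
  by apply/allP => _ /mapP[u _ ->].
move=> t; rewrite big_map /=.
have pos u : 0 <= c * phi (mul (inv (inv (mul t0 (inv u)))) t) by rewrite mulr_ge0.
have [Kt|nK] := pselect (K t); last by rewrite fK // sumr_ge0.
have [u us Uu] := Ks _ Kt; rewrite (big_rem u) //= ler_wpDr ?sumr_ge0 //.
rewrite invK (le_trans (fM t)) // /c mulrAC ler_pdivlMr ?divr_gt0 //.
by rewrite ler_wpM2l // ltW.
Qed.

Lemma le_cov f phi b : Cplus f -> bump phi ->
  (forall l, covers f phi l -> b <= \sum_(p <- l) p.1) -> b <= cov f phi.
Proof.
move=> Cf Bp bl; apply: lb_le_inf.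
  by have [l lc] := covers_exists Cf Bp; exists (\sum_(p <- l) p.1); exists l.
by move=> _ [l lc <-]; exact: bl.
Qed.

Lemma cov_ge0 f phi : Cplus f -> bump phi -> 0 <= cov f phi.
Proof. by move=> Cf Bp; apply: le_cov => // l [l0 _]; exact: sum_ge0. Qed.

Lemma cov_homo f g phi : Cplus g -> bump phi ->
  (forall t, f t <= g t) -> cov f phi <= cov g phi.
Proof.
move=> Cg Bp fg; apply: le_cov => // l [l0 gl]; apply: cov_le.
by split => // t; rewrite (le_trans (fg t)).
Qed.

Lemma covD f g phi : Cplus f -> Cplus g -> bump phi ->
  cov (fun t => f t + g t) phi <= cov f phi + cov g phi.
Proof.
move=> Cf Cg Bp; rewrite -lerBlDr; apply: le_cov => // l [l0 fl].
rewrite lerBlDl -lerBlDr; apply: le_cov => // l' [l0' gl'].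
rewrite lerBlDr addrC -big_cat; apply: cov_le; split; first by rewrite all_cat l0.
by move=> t; rewrite big_cat lerD.
Qed.

Let covZ_le a f phi : 0 <= a -> Cplus f -> bump phi ->
  cov (fun t => a * f t) phi <= a * cov f phi.
Proof.
rewrite le_eqVlt => /predU1P[<-|a0] Cf Bp.
  rewrite mul0r; apply: (@le_trans _ _ (\sum_(p <- [::] : seq (R * H)) p.1));
    last by rewrite big_nil.
  by apply: cov_le; split => // t; rewrite mul0r big_nil.
rewrite mulrC -ler_pdivrMr //; apply: le_cov => // l [l0 fl].
rewrite ler_pdivrMr // mulrC mulr_sumr.
rewrite -(big_map (fun p => (a * p.1, p.2)) xpredT (fun p : R * H => p.1)).
apply: cov_le; split.
  rewrite all_map; apply/allP => p pl /=.
  by apply: mulr_ge0; [exact: ltW|exact: (allP l0 _ pl)].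
move=> t; rewrite big_map /=; under eq_bigr do rewrite -mulrA.
by rewrite -mulr_sumr ler_pM2l.
Qed.

Lemma covZ a f phi : 0 <= a -> Cplus f -> bump phi ->
  cov (fun t => a * f t) phi = a * cov f phi.
Proof.
move=> a0 Cf Bp; apply: le_anti; rewrite covZ_le //=.
have /predU1P[<-|{}a0] : (0 == a) || (0 < a) by rewrite -le_eqVlt.
  by rewrite mul0r cov_ge0 //; apply: CplusZ.
rewrite -ler_pdivlMl //.
rewrite (le_trans _ (covZ_le _ (CplusZ (ltW a0) Cf) Bp)) ?invr_ge0 ?(ltW a0) //.
apply: cov_homo => //; last by move=> t; rewrite mulKf // gt_eqF.
by apply: CplusZ; [rewrite invr_ge0 ltW|apply: CplusZ => //; exact: ltW].
Qed.

Let cov_shift_le s f phi : Cplus f -> bump phi ->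
  cov (fun t => f (mul s t)) phi <= cov f phi.
Proof.
move=> Cf Bp; apply: le_cov => // l [l0 fl].
rewrite -(big_map (fun p => (p.1, mul (inv s) p.2)) xpredT (fun p : R * H => p.1)).
apply: cov_le; split; first by rewrite all_map.
move=> t; rewrite (le_trans (fl _)) // big_map /=; apply: ler_sum => p _.
by rewrite invM invK mulA.
Qed.

Lemma cov_shift s f phi : Cplus f -> bump phi ->
  cov (fun t => f (mul s t)) phi = cov f phi.
Proof.
move=> Cf Bp; apply: le_anti; rewrite cov_shift_le //=.
have := cov_shift_le (inv s) (Cplus_shift s Cf) Bp.
by under eq_fun do rewrite mulKV.
Qed.

(** Substituting a covering of [g] by translates of [phi] into a covering of [f] by translates of
    [g] multiplies the total weights. *)
Lemma cov_trans f g phi : Cplus f -> bump g -> bump phi ->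
  cov f phi <= cov f g * cov g phi.
Proof.
move=> Cf Bg Bp; have Cg := Bg.1.
have step l : covers f g l -> cov f phi <= (\sum_(p <- l) p.1) * cov g phi.
  (* Total weight 0 is treated apart because the general case divides by it; then [f] is at most 0
     and the empty list covers it. *)
  move=> [l0 fl];
    have /predU1P[l00|lp] : (0 == \sum_(p <- l) p.1) || (0 < \sum_(p <- l) p.1).
    by rewrite -le_eqVlt sum_ge0.
    rewrite -l00 mul0r; apply: (@le_trans _ _ (\sum_(p <- [::] : seq (R * H)) p.1));
      last by rewrite big_nil.
    apply: cov_le; split => // t; rewrite big_nil (le_trans (fl t)) //.
    rewrite big_seq_cond big1 // => p; rewrite andbT => pl.
    have /eqP := esym l00; rewrite big_seq_cond psumr_eq0; last first.
      by move=> q; rewrite andbT => ql; exact: (allP l0).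
    by move/allP => /(_ _ pl); rewrite pl /= => /eqP ->; rewrite mul0r.
  rewrite mulrC -ler_pdivrMr //; apply: le_cov => // l' [l0' gl'].
  rewrite ler_pdivrMr // mulrC mulr_suml.
  under eq_bigr do rewrite mulr_sumr.
  pose l2 := [seq (p.1 * q.1, mul p.2 q.2) | p <- l, q <- l'].
  have -> : \sum_(p <- l) \sum_(q <- l') p.1 * q.1 = \sum_(p <- l2) p.1.
    by rewrite /l2 big_allpairs_dep.
  apply: cov_le; split.
    apply/allP => _ /allpairsP[[p q] /= [pl ql ->]] /=.
    by apply: mulr_ge0; [exact: (allP l0 _ pl)|exact: (allP l0' _ ql)].
  move=> t; rewrite /l2 big_allpairs_dep /= (le_trans (fl t)) //.
  rewrite big_seq_cond [leRHS]big_seq_cond; apply: ler_sum => p; rewrite andbT => pl.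
  under eq_bigr do rewrite -mulrA; rewrite -mulr_sumr; apply: ler_wpM2l;
    first exact: (allP l0 _ pl).
  rewrite (le_trans (gl' _)) //; apply: ler_sum => q _.
  by rewrite invM -mulA.
have /predU1P[g0|g0] : (0 == cov g phi) || (0 < cov g phi).
  by rewrite -le_eqVlt cov_ge0.
  by rewrite -g0 mulr0; have [l lc] := covers_exists Cf Bg; have := step _ lc;
    rewrite -g0 mulr0.
rewrite -ler_pdivrMr //; apply: le_cov => // l lc.
by rewrite ler_pdivrMr // step.
Qed.

Lemma cov_gt0 f phi : Cplus f -> bump phi -> (exists t, 0 < f t) -> 0 < cov f phi.
Proof.
move=> Cf Bp [t ft]; have [M M0 pM] := Cplus_bounded Bp.1.
apply: (@lt_le_trans _ _ (f t / M)); first by rewrite divr_gt0.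
apply: le_cov => // l [l0 fl]; rewrite ler_pdivrMr // (le_trans (fl t)) //.
rewrite mulr_suml big_seq_cond [leRHS]big_seq_cond; apply: ler_sum => p.
by rewrite andbT => pl; apply: ler_wpM2l; [exact: (allP l0 _ pl)|exact: pM].
Qed.

(* Weil's argument: since [h_i = f_i / p] varies little on translates of the
   support of [phi], a covering of [p] by translates of [phi], weighted by the
   values of [h_i] at the translating points, covers [f_i]. *)
Lemma cov_almost_additive f g chi K (d : R) : Cplus f -> Cplus g -> Cplus chi ->
  compact K -> (forall t, ~ K t -> f t = 0) -> (forall t, ~ K t -> g t = 0) ->
  (forall t, K t -> chi t = 1) -> 0 < d ->
  exists2 V, nbhs one V & forall phi, bump phi -> (forall t, ~ V t -> phi t = 0) ->
    cov f phi + cov g phi <= (1 + 2 * d) * cov (fun t => (f t + g t) + d * chi t) phi.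
Proof.
move=> Cf Cg Cchi cK fK gK chiK d0.
set p := fun t => (f t + g t) + d * chi t.
have Cp : Cplus p by apply: CplusD; [exact: CplusD|apply: CplusZ => //; exact: ltW].
have [cp p0 _] := Cp; have [_ f0 _] := Cf; have [_ g0 _] := Cg.
have pK t : K t -> 0 < p t.
  by move=> Kt; rewrite /p chiK // mulr1 ltr_wpDl // addr_ge0.
have Ch k : Cplus k -> (forall t, ~ K t -> k t = 0) -> Cplus (fun t => k t / p t).
  by move=> Ck kK; exact: (Cplus_div lH.2 Ck cK kK cp p0 pK).
have V1 := left_uniform (Ch _ Cf fK) d0; have V2 := left_uniform (Ch _ Cg gK) d0.
have half k V phi l : Cplus k -> (forall t, ~ K t -> k t = 0) ->
    (forall v, V v -> forall t, `|k (mul t v) / p (mul t v) - k t / p t| <= d) ->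
    bump phi -> (forall t, ~ V t -> phi t = 0) -> covers p phi l ->
    cov k phi <= \sum_(q <- l) q.1 * (k q.2 / p q.2 + d).
  move=> Ck kK Vk [Cphi _] phiV [l0 pl]; have [_ phi0 _] := Cphi; have [_ k0 _] := Ck.
  have h0 t : 0 <= k t / p t by rewrite divr_ge0.
  rewrite -(big_map (fun q => (q.1 * (k q.2 / p q.2 + d), q.2)) xpredT
    (fun q : R * H => q.1)).
  apply: cov_le; split.
    rewrite all_map; apply/allP => q ql /=.
    by apply: mulr_ge0; [exact: (allP l0 _ ql)|rewrite addr_ge0 // ltW].
  move=> t; rewrite big_map /=.
  have -> : k t = (k t / p t) * p t.
    have [Kt|nK] := pselect (K t); first by rewrite divfK // gt_eqF // pK.
    by rewrite kK // !mul0r.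
  apply: (le_trans (ler_wpM2l (h0 t) (pl t))); rewrite mulr_sumr.
  rewrite big_seq_cond [leRHS]big_seq_cond; apply: ler_sum => q; rewrite andbT => ql.
  rewrite mulrCA -mulrA; apply: ler_wpM2l; first exact: (allP l0 _ ql).
  have [Vt|nV] := pselect (V (mul (inv q.2) t)); last by rewrite phiV // !mulr0.
  apply: ler_wpM2r => //; rewrite -lerBlDl.
  by have := Vk _ Vt q.2; rewrite mulKV => /(le_trans (ler_norm _)).
exists ([set v | forall t, `|f (mul t v) / p (mul t v) - f t / p t| <= d] `&`
        [set v | forall t, `|g (mul t v) / p (mul t v) - g t / p t| <= d]).
  exact: filterI.
move=> phi Bphi phiV.
have d1 : 0 < 1 + 2 * d by rewrite ltr_wpDr // mulr_ge0 // ltW.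
rewrite mulrC -ler_pdivrMr //; apply: le_cov => // l lc; rewrite ler_pdivrMr //.
rewrite (le_trans (lerD (half f _ _ _ Cf fK _ Bphi phiV lc)
  (half g _ _ _ Cg gK _ Bphi phiV lc))) //; try by move=> v [].
rewrite -big_split /= mulr_suml big_seq_cond [leRHS]big_seq_cond.
apply: ler_sum => q; rewrite andbT => ql; rewrite -mulrDr.
apply: ler_wpM2l; first exact: (allP lc.1 _ ql).
rewrite addrACA -mulrDl -mulr2n -[d *+ 2]mulr_natl lerD2r.
have [Kt|nK] := pselect (K q.2); last by rewrite fK // gK // addr0 mul0r.
rewrite ler_pdivrMr ?pK // GRing.mul1r /p lerDl mulr_ge0 ?(ltW d0) //.
by case: Cchi.
Qed.

(** Convergence along this filter means that the support of [phi] shrinks to [one]. *)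
Let bumps : set_system (H -> R) := [set P | exists2 V, nbhs one V &
  forall phi, bump phi -> (forall t, ~ V t -> phi t = 0) -> P phi].

Let bumps_proper : ProperFilter bumps.
Proof.
apply: Build_ProperFilter_ex.
  move=> P [V oV VP]; have [f [Cf _ f1 [C cC [CV fC]]]] := @lch_bump_pt R _ _ _ lH oV.
  exists f; apply: VP; first by split => //; exists one; rewrite f1.
  by move=> t nV; apply: fC => /CV.
split.
- by exists setT => //; exact: filterT.
- move=> P Q [V oV VP] [W oW WQ]; exists (V `&` W); first exact: filterI.
  move=> phi Bp pVW; split; [apply: VP|apply: WQ] => // t nt; apply: pVW => -[] //.
- by move=> P Q PQ [V oV VP]; exists V => // phi Bp pV; apply: PQ; exact: VP.
Qed.

(** The ratio of the covering numbers of [f] and [F] lies between 0 and [cov f F] whatever [phi], so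
    it converges along an ultrafilter refining [bumps]. Subadditivity, homogeneity and invariance
    hold for every [phi]; superadditivity is obtained only in the limit. *)
Lemma haar_functional_exists : exists L : (H -> R) -> R,
  [/\ positive_functional L, left_invariant mul L & strictly_positive L].
Proof.
have [U [UU bU]] := ultraFilterLemma bumps_proper.
have PU : ProperFilter U by exact: ultra_proper.
have [F [CF _ F1 _]] := @lch_bump_pt R _ one setT lH filterT.
have BF : bump F by split => //; exists one; rewrite F1.
have UB V (P : set (H -> R)) : nbhs one V ->
    (forall phi, bump phi -> (forall t, ~ V t -> phi t = 0) -> P phi) -> U P.
  by move=> oV VP; apply: bU; exists V.
have UBT (P : set (H -> R)) : (forall phi, bump phi -> P phi) -> U P.
  by move=> BP; apply: (UB setT); [exact: filterT|move=> phi Bp _; exact: BP].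
pose N f (phi : H -> R) := cov f phi / cov F phi.
have F0 phi : bump phi -> 0 < cov F phi by move=> Bp; apply: cov_gt0 => //; exact: BF.2.
have /choice[L NL] : forall f, exists l : R, Cplus f -> N f phi @[phi --> U] --> l.
  move=> f; have [Cf|nCf] := pselect (Cplus f); last by exists 0.
  have [|l Hl] := @ultra_bounded_cvg R _ U (N f) (cov f F) UU; last by exists l.
  apply: UBT => phi Bp /=; rewrite /N divr_ge0 ?cov_ge0 ?(ltW (F0 _ Bp)) //=.
  by rewrite ler_pdivrMr ?F0 // cov_trans.
have N0 f phi : Cplus f -> bump phi -> 0 <= N f phi.
  by move=> Cf Bp; rewrite /N divr_ge0 ?cov_ge0 ?(ltW (F0 _ Bp)).
have L0 f : Cplus f -> 0 <= L f.
  move=> Cf; apply: (filter_cvg_le PU (cvg_cst 0) (NL _ Cf)).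
  by apply: UBT => phi Bp; exact: N0.
have LD f g : Cplus f -> Cplus g -> L (fun t => f t + g t) = L f + L g.
  move=> Cf Cg; have Cfg := CplusD Cf Cg.
  have cD : N f phi + N g phi @[phi --> U] --> L f + L g by apply: cvgD; exact: NL.
  apply: le_anti; apply/andP; split.
    apply: (filter_cvg_le PU (NL _ Cfg) cD).
    apply: UBT => phi Bp /=; rewrite /N -mulrDl ler_pM2r ?invr_gt0 ?F0 //.
    exact: covD.
  have [_ _ [K cK fK]] := Cfg.
  have [chi [Cchi _ chi1 _]] := @lch_bump R H K setT lH cK openT (fun _ _ => I).
  have [_ f0 _] := Cf; have [_ g0 _] := Cg.
  have fK' t : ~ K t -> f t = 0.
    by move=> /fK /eqP; rewrite paddr_eq0 // => /andP[/eqP].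
  have gK' t : ~ K t -> g t = 0.
    by move=> /fK /eqP; rewrite paddr_eq0 // => /andP[_ /eqP].
  have key d : 0 < d -> L f + L g <= (1 + 2 * d) * (L (fun t => f t + g t) + d * L chi).
    move=> d0; have [V oV Vd] := cov_almost_additive Cf Cg Cchi cK fK' gK' chi1 d0.
    have cR : (1 + 2 * d) * (N (fun t => f t + g t) phi + d * N chi phi) @[phi --> U]
      -->
        (1 + 2 * d) * (L (fun t => f t + g t) + d * L chi).
      by apply: cvgM; [exact: cvg_cst|apply: cvgD; [exact: NL|apply: cvgM;
        [exact: cvg_cst|exact: NL]]].
    apply: (filter_cvg_le PU cD cR); apply: (UB V) => // phi Bp pV /=.
    rewrite /N [d * (_ / _)]mulrA -!mulrDl mulrA ler_pM2r ?invr_gt0 ?F0 //.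
    apply: (le_trans (Vd _ Bp pV)); rewrite ler_pM2l; last first.
      by rewrite ltr_wpDr // mulr_ge0 // ltW.
    rewrite -(covZ (ltW d0) Cchi Bp).
    apply: (@covD (fun t => f t + g t) (fun t => d * chi t)) => //.
    by apply: CplusZ => //; exact: ltW.
  have A0 : 0 <= L (fun t => f t + g t) by exact: L0.
  have C0 : 0 <= L chi by exact: L0.
  apply/ler_addgt0Pr => e e0.
  move: A0 C0 key;
    move: (L (fun t => f t + g t)) (L chi) (L f + L g) => A C B A0 C0 key.
  have S0 : 0 < 2 * A + 3 * C + 1 by lra.
  (* For [d <= 1] one has [(1 + 2 d) (A + d C) <= A + d (2 A + 3 C)]; the added 1 keeps the
     denominator positive. *)
  pose d := Num.min 1 (e / (2 * A + 3 * C + 1)).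
  have d0 : 0 < d by rewrite lt_min ltr01 divr_gt0.
  have d1 : d <= 1 by rewrite ge_min lexx.
  have de : d * (2 * A + 3 * C + 1) <= e by rewrite -ler_pdivlMr // ge_min lexx orbT.
  have h : d * (d * C) <= d * C by rewrite ler_wpM2l ?(ltW d0) // ler_piMl.
  by have := key _ d0; lra.
have LZ a f : 0 <= a -> Cplus f -> L (fun t => a * f t) = a * L f.
  move=> a0 Cf.
  have cR : a * N f phi @[phi --> U] --> a * L f by apply: cvgM;
    [exact: cvg_cst|exact: NL].
  apply: (filter_cvg_eq PU (NL _ (CplusZ a0 Cf)) cR).
  by apply: UBT => phi Bp /=; rewrite /N covZ // mulrA.
exists L; split; first by split.
- move=> s f Cf; apply: (filter_cvg_eq PU (NL _ (Cplus_shift s Cf)) (NL _ Cf)).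
  by apply: UBT => phi Bp /=; rewrite /N cov_shift.
- move=> f Cf fp; have Bf : bump f by split.
  have cFf : 0 < cov F f by exact: cov_gt0 BF.2.
  (* [cov F phi <= cov F f * cov f phi] bounds every ratio below by the inverse of [cov F f], so the
     limit cannot be 0. *)
  apply: (@lt_le_trans _ _ (cov F f)^-1); first by rewrite invr_gt0.
  apply: (filter_cvg_le PU (cvg_cst _) (NL _ Cf)).
  apply: UBT => phi Bp /=; rewrite /N ler_pdivlMr ?F0 // mulrC ler_pdivrMr //.
  by rewrite mulrC cov_trans.
Qed.

(* For [g] concentrated near [one], [f t * L (g o inv)] is close to
   [L (fun y => f y * g (y^-1 t))], which a fine partition of [f] turns into a
   finite sum of left translates of [g]. *)
Lemma haar_approx (L : (H -> R) -> R) f K e :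
  positive_functional L -> left_invariant mul L -> strictly_positive L ->
  Cplus f -> compact K -> (forall t, ~ K t -> f t = 0) -> 0 < e ->
  exists2 V, nbhs one V & forall g, bump g -> (forall t, ~ V t -> g t = 0) ->
    exists l : seq (R * H), [/\ forall p, p \in l -> 0 <= p.1 /\ K p.2,
      \sum_(p <- l) p.1 = L f / L (fun t => g (inv t)) &
      forall t, `|f t - \sum_(p <- l) p.1 * g (mul (inv p.2) t)| <= e].
Proof.
move=> hL iL sL Cf cK fK e0; have e2 : 0 < e / 2 by rewrite divr_gt0.
exists [set v | forall t, `|f (mul t v) - f t| <= e / 2].
  exact: left_uniform.
move=> g [Cg [t0 gt0]] gV; have [cg g0 _] := Cg; have [cf f0 _] := Cf.
have Cgi := Cplus_inv Cg; set kap := L (fun t => g (inv t)).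
have kap0 : 0 < kap by apply: (sL _ Cgi); exists (inv t0); rewrite invK.
have [L0 LD LZ] := hL.
have Lf0 : 0 <= L f by exact: L0.
have Lf1 : 0 < L f + 1 by rewrite ltr_wpDl.
(* Chosen to give [e' * L f <= e / 2 * kap]; the 1 covers the case [L f = 0]. *)
pose e' := e / 2 * kap / (L f + 1).
have e'0 : 0 < e' by rewrite divr_gt0 // mulr_gt0.
have e'L : e' * L f <= e / 2 * kap.
  rewrite /e' mulrAC ler_pdivrMr //; apply: ler_wpM2l; last by rewrite lerDl.
  by rewrite mulr_ge0 // ltW.
have W := right_uniform Cg e'0; set Wset := [set v | _] in W.
have [|s [h [sK sh fE]]] := Cplus_decomp (U := fun u => mul (inv u) @^-1` Wset) lH Cf
  cK fK.
  move=> u _; have := @continuous_mull (inv u) u; rewrite /continuous_at mulV.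
  by move=> /(_ _ W).
have Ch u : u \in s -> Cplus (h u) by move=> /sh[].
have LfE : L f = \sum_(u <- s) L (h u).
  rewrite big_seq_cond -(positive_functional_sum hL); last by move=> u /andP[/Ch].
  by congr L; apply/funext => t; rewrite fE big_seq_cond.
(* The piece [h u] lives near [u], where [g (y^-1 t)] is nearly [g (u^-1 t)], so its integral
   contributes about [L (h u)] times that translate. *)
exists [seq (L (h u) / kap, u) | u <- s]; split.
- move=> _ /mapP[u us ->] /=; split; last exact: sK.
  by apply: divr_ge0; [apply: L0; exact: Ch|exact: ltW].
- by rewrite big_map /= -mulr_suml -LfE.
move=> t; rewrite big_map /=.
set S := \sum_(u <- s) _.
have SE : kap * S = \sum_(u <- s) L (h u) * g (mul (inv u) t).
  rewrite /S mulr_sumr; apply: eq_bigr => u _.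
  by rewrite mulrA mulrCA divff ?gt_eqF // mulr1.
(* As [y^-1 t] is the inverse of [t^-1 y], left invariance gives [L gt = kap] for every [t]. *)
pose gt y := g (mul (inv y) t).
have gtE : gt = fun y => g (inv (mul (inv t) y)).
  by apply/funext => y; rewrite /gt invM invK.
have Cgt : Cplus gt by rewrite gtE; exact: (Cplus_shift (inv t) Cgi).
have Lgt : L gt = kap by rewrite gtE; exact: (iL (inv t) _ Cgi).
have gt0' y : 0 <= gt y by exact: g0.
(* [L q] links the two sides: it is within [e / 2 * kap] of [f t * kap], since [f] differs from
   [f t] by at most [e / 2] where [gt] is nonzero, and within [e' * L f] of [kap * S], since [gt]
   varies by at most [e'] around [u] on the piece [h u]. *)
pose q y := f y * gt y.
have Cq : Cplus q by exact: CplusM.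
have near1 y : `|f t - f y| * gt y <= e / 2 * gt y.
  have [Vy|nV] := pselect (forall z, `|f (mul z (mul (inv y) t)) - f z| <= e / 2).
    by apply: ler_wpM2r => //; have := Vy y; rewrite mulKV.
  by rewrite /gt gV // !mulr0.
have q1 : L q <= (f t + e / 2) * kap.
  rewrite -Lgt -LZ //; last by rewrite addr_ge0 // ltW.
  apply: (positive_functional_le hL) => //.
    by apply: CplusZ => //; rewrite addr_ge0 // ltW.
  move=> y; have := near1 y; have := ler_norm (- (f t - f y)); rewrite normrN.
  move=> /(ler_wpM2r (gt0' y)) h1 h2; rewrite /q; lra.
have q2 : f t * kap <= L q + e / 2 * kap.
  rewrite -Lgt -(LZ _ gt (f0 t) Cgt) -(LZ _ gt (ltW e2) Cgt) -LD //;
    last by apply: CplusZ => //; exact: ltW.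
  apply: (positive_functional_le hL); [exact: CplusZ| |].
    by apply: CplusD => //; apply: CplusZ => //; exact: ltW.
  move=> y; have := near1 y; have := ler_norm (f t - f y).
  move=> /(ler_wpM2r (gt0' y)) h1 h2; rewrite /q; lra.
have near2 u y : u \in s -> `|gt y - g (mul (inv u) t)| * h u y <= e' * h u y.
  move=> us; have [[_ hu0 _] _ [C cC [CU hC]]] := sh _ us.
  have [/CU Wy|nC] := pselect (C y); last by rewrite hC // !mulr0.
  apply: ler_wpM2r => //; have := Wy (mul (inv u) t).
  by rewrite invM invK -mulA mulKV.
have Chc u c : u \in s -> 0 <= c -> Cplus (fun y => c * h u y).
  by move=> us c0; apply: CplusZ => //; exact: Ch.
have q3 : L q <= kap * S + e' * L f.
  rewrite SE LfE mulr_sumr -big_split /= big_seq_cond.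
  rewrite (eq_bigr (fun u => L (fun y => (g (mul (inv u) t) + e') * h u y)));
    last first.
    move=> u /andP[us _]; rewrite LZ; [ring|by rewrite addr_ge0 // ltW|exact: Ch].
  rewrite -(positive_functional_sum hL); last first.
    by move=> u /andP[us _]; apply: Chc => //; rewrite addr_ge0 // ltW.
  apply: (positive_functional_le hL) => //.
    apply: Cplus_sum => u /andP[us _]; apply: Chc => //; rewrite addr_ge0 // ltW //.
  move=> y; rewrite /q fE mulr_suml big_seq_cond; apply: ler_sum => u /andP[us _].
  have := near2 u y us; have := ler_norm (gt y - g (mul (inv u) t)).
  have [hu0 _] : (0 <= h u y) /\ True by split => //; case: (Ch u us).
  by move=> /(ler_wpM2r hu0) h1 h2; lra.
have q4 : kap * S <= L q + e' * L f.
  rewrite SE big_seq_cond.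
  rewrite (eq_bigr (fun u => L (fun y => g (mul (inv u) t) * h u y))); last first.
    by move=> u /andP[us _]; rewrite LZ; [exact: mulrC|exact: g0|exact: Ch].
  rewrite -(positive_functional_sum hL); last by move=> u /andP[us _]; exact: Chc.
  rewrite -(LZ _ f (ltW e'0) Cf) -LD //; last by apply: CplusZ => //; exact: ltW.
  apply: (positive_functional_le hL).
  - by apply: Cplus_sum => u /andP[us _]; exact: Chc.
  - by apply: CplusD => //; apply: CplusZ => //; exact: ltW.
  - move=> y; rewrite /q fE mulr_suml mulr_sumr -big_split /= [leRHS]big_seq_cond.
    apply: ler_sum => u /andP[us _].
    have := near2 u y us; have := ler_norm (- (gt y - g (mul (inv u) t))).
    have [hu0 _] : (0 <= h u y) /\ True by split => //; case: (Ch u us).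
    by rewrite normrN => /(ler_wpM2r hu0) h1 h2; lra.
rewrite ler_norml; apply/andP; split; rewrite -(ler_pM2r kap0); nra.
Qed.

End Group.

Lemma injective_hausdorff (S T : topologicalType) (f : S -> T) :
  continuous f -> injective f -> hausdorff_space T -> hausdorff_space S.
Proof.
move=> cf injf hT p q pq; apply/injf/hT => A B Ap Bq.
have [z [Az Bz]] := pq (f @^-1` A) (f @^-1` B) (cf p _ Ap) (cf q _ Bq).
by exists (f z).
Qed.

Lemma near_neq (T : topologicalType) (I : Type) (F : set_system I) (u v : I -> T)
    (p q : T) : Filter F -> hausdorff_space T -> u @ F --> p -> v @ F --> q ->
  p <> q -> \forall z \near F, u z <> v z.
Proof.
move=> FF; rewrite open_hausdorff => hT up vq /eqP /hT[[A B]] /=.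
rewrite !inE => -[Ap Bq] [oA oB AB].
have FA : F (u @^-1` A) by apply: up; exact: open_nbhs_nbhs.
have FB : F (v @^-1` B) by apply: vq; exact: open_nbhs_nbhs.
apply: filterS (filterI FA FB) => z [/= Az Bz] uv.
have : (A `&` B) (u z) by split => //; rewrite uv.
by rewrite AB.
Qed.

Lemma closed_equalizer (S T : topologicalType) (u v : S -> T) :
  hausdorff_space T -> continuous u -> continuous v -> closed [set z | u z = v z].
Proof.
move=> hT cu cv; rewrite -[X in closed X]setCK; apply: open_closedC.
rewrite openE => z /= uvz; rewrite /interior.
exact: near_neq hT (cu z) (cv z) uvz.
Qed.

Lemma closed_set_val_compact (T : topologicalType) (A C : set T) :
  closed A -> compact C -> compact (set_val @^-1` C : set A).
Proof.
move=> clA cC F PF FC.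
have cCA : compact (C `&` A) by exact: compact_closedI.
have [|y [[Cy Ay] Fy]] := cCA (set_val @ F) _.
  change (F (set_val @^-1` (C `&` A))); apply: filterS FC => a /= Ca.
  by split => //; exact: (set_valP a).
exists (exist _ y (mem_set Ay) : A); split => //.
move=> B N FB [_ [[W oW <-] /= Wy WN]].
have FB' : (set_val @ F) (set_val @` B).
  change (F (set_val @^-1` (set_val @` B))); apply: filterS FB => b Bb; by exists b.
have [|z [[b Bb bz] Wz]] := Fy _ W FB'; first exact: open_nbhs_nbhs.
by exists b; split => //; apply: WN; rewrite /= bz.
Qed.

Lemma closed_set_type_lch (T : topologicalType) (A : set T) :
  lch_space T -> closed A -> lch_space A.
Proof.
move=> lT clA; split; last first.
  apply: (@injective_hausdorff A T set_val) lT.2; first exact: initial_continuous.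
  exact: val_inj.
move=> x _; have [C cC [_ xC]] := lch_nbhs_compact lT (filterT : nbhs (set_val x) setT).
exists (set_val @^-1` C).
  by rewrite withinET; exact: (@initial_continuous A T set_val x).
split; first exact: closed_set_val_compact.
apply: preimage_closed; last exact: (compact_closed lT.2 cC).
by move=> t _; exact: initial_continuous.
Qed.

(** * Isotropy groups and the continuity of their Haar functionals *)

Section GroupoidAxioms.
Context {G X : topologicalType}.
Variables (r s : G -> X) (e : X -> G) (m : G -> G -> G) (i : G -> G).
Hypothesis gG : is_locally_compact_groupoid r s e m i.

Lemma lc_lchG : lch_space G. Proof. by case: gG. Qed.
Lemma lc_lchX : lch_space X. Proof. by case: gG. Qed.

Lemma continuous_range : continuous r. Proof. by case: gG => -[_ []]. Qed.
Lemma continuous_source : continuous s. Proof. by case: gG => -[_ []]. Qed.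
Lemma continuous_unit : continuous e. Proof. by case: gG => -[]. Qed.
Lemma continuous_inverse : continuous i. Proof. by case: gG => -[]. Qed.

Let axioms : is_groupoid r s e m i. Proof. by case: gG => -[]. Qed.

Lemma range_mul a b : s a = r b -> r (m a b) = r a.
Proof. by case: axioms => H _ _ _ _ /H[]. Qed.
Lemma source_mul a b : s a = r b -> s (m a b) = s b.
Proof. by case: axioms => H _ _ _ _ /H[]. Qed.
Lemma groupoid_mulA a b c : s a = r b -> s b = r c -> m (m a b) c = m a (m b c).
Proof. by case: axioms => _ H _ _ _; exact: H. Qed.
Lemma range_unit x : r (e x) = x.
Proof. by case: axioms => _ _ H _ _; case: (H x). Qed.
Lemma source_unit x : s (e x) = x.
Proof. by case: axioms => _ _ H _ _; case: (H x). Qed.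
Lemma mul_unitl a : m (e (r a)) a = a.
Proof. by case: axioms => _ _ _ H _; case: (H a). Qed.
Lemma mul_unitr a : m a (e (s a)) = a.
Proof. by case: axioms => _ _ _ H _; case: (H a). Qed.
Lemma range_inv a : r (i a) = s a.
Proof. by case: axioms => _ _ _ _ H; case: (H a). Qed.
Lemma source_inv a : s (i a) = r a.
Proof. by case: axioms => _ _ _ _ H; case: (H a). Qed.
Lemma mul_invr a : m a (i a) = e (r a).
Proof. by case: axioms => _ _ _ _ H; case: (H a). Qed.
Lemma mul_invl a : m (i a) a = e (s a).
Proof. by case: axioms => _ _ _ _ H; case: (H a). Qed.

Lemma continuous_mul : {within composable r s, continuous (fun p : G * G => m p.1 p.2)}.
Proof. by case: gG => -[]. Qed.

Lemma groupoid_mulK a b : r a = r b -> m a (m (i a) b) = b.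
Proof. by move=> ab;
  rewrite -groupoid_mulA ?range_inv ?source_inv // mul_invr ab mul_unitl. Qed.

Lemma groupoid_mulVK a b : s a = r b -> m (i a) (m a b) = b.
Proof. by move=> ab; rewrite -groupoid_mulA ?source_inv // mul_invl ab mul_unitl. Qed.

Lemma continuous_composable a b (W : set G) : s a = r b -> nbhs (m a b) W ->
  exists A B, [/\ nbhs a A, nbhs b B &
    forall a' b', A a' -> B b' -> s a' = r b' -> W (m a' b')].
Proof.
move=> ab abW; have /subspace_continuousP/(_ (a, b) ab _ abW) := continuous_mul.
rewrite /= => -[[A B] /= [aA bB] AB]; exists A, B; split => // a' b' Aa Bb sr.
exact: (AB (a', b')).
Qed.

Lemma compact_composable (A B : set G) : compact A -> compact B ->
  compact [set m p.1 p.2 | p in (A `*` B) `&` composable r s].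
Proof.
move=> cA cB; apply: continuous_compact.
  by apply: continuous_subspaceW continuous_mul => p [].
apply: compact_closedI; first exact: compact_setX.
apply: closed_equalizer; first exact: lc_lchX.2.
  by move=> p; apply: continuous_comp; [exact: cvg_fst|exact: continuous_source].
by move=> p; apply: continuous_comp; [exact: cvg_snd|exact: continuous_range].
Qed.

End GroupoidAxioms.

Section Isotropy.
Context {R : realType} {G X : topologicalType}.
Variables (r s : G -> X) (e : X -> G) (m : G -> G -> G) (i : G -> G).
Hypothesis gG : is_locally_compact_groupoid r s e m i.

Let lG := lc_lchG gG.
Let lX := lc_lchX gG.
Let rC := continuous_range gG.
Let sC := continuous_source gG.
Let eC := continuous_unit gG.
Let iC := continuous_inverse gG.
Let rM := range_mul gG.
Let sM := source_mul gG.
Let mA := groupoid_mulA gG.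
Let re := range_unit gG.
Let se := source_unit gG.
Let em := mul_unitl gG.
Let ri := range_inv gG.
Let si := source_inv gG.
Let im := mul_invl gG.

Definition isotropy (x : X) : set G := [set g | r g = x /\ s g = x].

Lemma closed_isotropy x : closed (isotropy x).
Proof.
have hX := lX.2; rewrite (_ : isotropy x = [set g | r g = x] `&` [set g | s g = x]) //.
by apply: closedI; apply: closed_equalizer => // z; exact: cst_continuous.
Qed.

Lemma isotropy_mul x a b : isotropy x a -> isotropy x b -> isotropy x (m a b).
Proof. by move=> [ra sa] [rb sb]; split; rewrite ?rM ?sM // sa rb. Qed.

Lemma isotropy_inv x a : isotropy x a -> isotropy x (i a).
Proof. by move=> [ra sa]; split; rewrite ?ri ?si. Qed.

Lemma isotropy_id x : isotropy x (e x).
Proof. by split; rewrite ?re ?se. Qed.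

Definition iso_mul x (a b : isotropy x) : isotropy x :=
  exist (fun g => g \in isotropy x) _ (mem_set (isotropy_mul (set_valP a) (set_valP
    b))).
Definition iso_inv x (a : isotropy x) : isotropy x :=
  exist (fun g => g \in isotropy x) _ (mem_set (isotropy_inv (set_valP a))).
Definition iso_id x : isotropy x :=
  exist (fun g => g \in isotropy x) _ (mem_set (isotropy_id x)).

Lemma isotropy_lc_group x : is_lc_group (@iso_mul x) (iso_id x) (@iso_inv x).
Proof.
split.
- by apply: closed_set_type_lch; [exact: lG|exact: closed_isotropy].
- split.
  + move=> a b c; apply: val_inj => /=.
    have [[ra sa] [rb sb] [rc sc]] := And3 (set_valP a) (set_valP b) (set_valP c).
    by rewrite mA // ?sa ?sb ?rb ?rc.
  + move=> a; apply: val_inj => /=; have [ra sa] := set_valP a.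
    by rewrite -{1}ra em.
  + move=> a; apply: val_inj => /=; have [ra sa] := set_valP a.
    by rewrite im sa.
- apply: (continuous_comp_initial (w := set_val)) => -[a b] W /= abW.
  have [ra sa] := set_valP a; have [rb sb] := set_valP b.
  have [|A [B [aA bB AB]]] := continuous_composable gG _ abW; first by rewrite sa rb.
  exists (set_val @^-1` A, set_val @^-1` B) => /=.
    by split; apply: initial_continuous.
  move=> [a' b'] /= [Aa Bb]; apply: AB => //.
  by have [_ ->] := set_valP a'; have [-> _] := set_valP b'.
- apply: (continuous_comp_initial (w := set_val)) => a.
  apply: (@continuous_comp _ _ _ set_val i); last exact: iC.
  exact: initial_continuous.
Qed.

Definition fibre_Cplus x (f : G -> R) : Prop :=
  Cplus (fun t : isotropy x => f (set_val t)).

Lemma Cplus_fibre x f : Cplus f -> fibre_Cplus x f.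
Proof.
move=> [cf f0 [K cK fK]]; split => //.
  move=> t; apply: (@continuous_comp _ _ _ set_val f); last exact: cf.
  exact: initial_continuous.
exists (set_val @^-1` K); last by move=> t; exact: fK.
by apply: closed_set_val_compact => //; exact: closed_isotropy.
Qed.

Lemma fibre_Cplus_shift x h f : isotropy x h -> fibre_Cplus x f ->
  fibre_Cplus x (fun t => f (m h t)).
Proof.
move=> xh Cf; pose h' : isotropy x := exist (fun g => g \in isotropy x) h (mem_set xh).
exact: (Cplus_shift (isotropy_lc_group x) h' Cf).
Qed.

Lemma fibre_Cplus_ext x f g : (forall t, isotropy x t -> f t = g t) ->
  fibre_Cplus x f -> fibre_Cplus x g.
Proof.
move=> fg; rewrite /fibre_Cplus.
suff -> : (fun t : isotropy x => f (set_val t)) = (fun t => g (set_val t)) by [].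
by apply/funext => t; apply: fg; exact: set_valP.
Qed.

Definition haar_family (L : forall x, (isotropy x -> R) -> R) : Prop :=
  forall x, [/\ positive_functional (L x), left_invariant (@iso_mul x) (L x) &
                strictly_positive (L x)].

Lemma haar_family_exists : exists L, haar_family L.
Proof.
exists (fun x => projT1 (cid (haar_functional_exists (isotropy_lc_group x)))) => x.
by case: cid.
Qed.

Section HaarFamily.
Variable L : forall x, (isotropy x -> R) -> R.
Hypothesis hL : haar_family L.

(** Integrands live on all of [G], so that one function can be integrated over every fibre without
    dependent types. *)
Definition fib x (f : G -> R) : R := L (fun t : isotropy x => f (set_val t)).

Lemma fib_ge0 x f : fibre_Cplus x f -> 0 <= fib x f.
Proof. by move=> Cf; case: (hL x) => -[H _ _] _ _; exact: H. Qed.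

Lemma fib_le x f g : fibre_Cplus x f -> fibre_Cplus x g ->
  (forall t, isotropy x t -> f t <= g t) -> fib x f <= fib x g.
Proof.
move=> Cf Cg fg; case: (hL x) => H _ _; apply: (positive_functional_le H) => // t.
by apply: fg; exact: set_valP.
Qed.

Lemma fib_ext x f g : (forall t, isotropy x t -> f t = g t) -> fib x f = fib x g.
Proof.
by move=> fg; congr (L _); apply/funext => t; apply: fg; exact: set_valP.
Qed.

Lemma fibD x f g : fibre_Cplus x f -> fibre_Cplus x g ->
  fib x (fun t => f t + g t) = fib x f + fib x g.
Proof. by move=> Cf Cg; case: (hL x) => -[_ H _] _ _; exact: H. Qed.

Lemma fibZ x a f : 0 <= a -> fibre_Cplus x f -> fib x (fun t => a * f t) = a * fib x f.
Proof. by move=> a0 Cf; case: (hL x) => -[_ _ H] _ _; exact: H. Qed.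

Lemma fib_sum x (I : Type) (l : seq I) (P : pred I) (f : I -> G -> R) :
  (forall j, P j -> fibre_Cplus x (f j)) ->
  fib x (fun t => \sum_(j <- l | P j) f j t) = \sum_(j <- l | P j) fib x (f j).
Proof. by case: (hL x) => H _ _; exact: (positive_functional_sum H). Qed.

Lemma fib0 x : fib x (fun=> 0) = 0.
Proof. by case: (hL x) => H _ _; exact: (positive_functional0 H). Qed.

Lemma fib_shift x h f : isotropy x h -> fibre_Cplus x f ->
  fib x (fun t => f (m h t)) = fib x f.
Proof.
move=> xh Cf; case: (hL x) => _ H _.
pose h' : isotropy x := exist (fun g => g \in isotropy x) h (mem_set xh).
exact: (H h' _ Cf).
Qed.

Lemma fib_gt0 x f : fibre_Cplus x f -> (exists2 t, isotropy x t & 0 < f t) -> 0 < fib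
  x f.
Proof.
move=> Cf [t xt ft]; case: (hL x) => _ _; apply => //.
by exists (exist (fun g => g \in isotropy x) t (mem_set xt)).
Qed.

Lemma near_not_isotropy (Y : topologicalType) (sg : Y -> X) (y0 : Y) (t0 : G) :
  sg @ y0 --> sg y0 -> ~ isotropy (sg y0) t0 ->
  \forall t \near t0 & y \near y0, ~ isotropy (sg y) t.
Proof.
move=> csg /not_andP nxt.
have cs2 : sg p.2 @[p --> (t0, y0)] --> sg y0 by exact: (cvg_comp _ _ cvg_snd csg).
case: nxt => nt.
  have cr : r p.1 @[p --> (t0, y0)] --> r t0 by apply: (cvg_comp fst r);
    [exact: cvg_fst|exact: rC].
  by apply: filterS (near_neq _ lX.2 cr cs2 nt) => p np [].
have cs : s p.1 @[p --> (t0, y0)] --> s t0 by apply: (cvg_comp fst s);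
  [exact: cvg_fst|exact: sC].
by apply: filterS (near_neq _ lX.2 cs cs2 nt) => p np [].
Qed.

(** Compactness of [C] makes the neighbourhood of [y0] uniform. Points of [C] off the fibre over
    [sg y0] cost nothing: as [X] is Hausdorff, points near them avoid all nearby fibres, and the
    claim is vacuous there. *)
Lemma tube (Y : topologicalType) (sg : Y -> X) (y0 : Y) (C : set G) (P : Y -> G ->
  Prop) :
  sg @ y0 --> sg y0 -> compact C ->
  (forall t0, C t0 -> isotropy (sg y0) t0 ->
     \forall t \near t0 & y \near y0, isotropy (sg y) t -> P y t) ->
  \forall y \near y0, forall t, C t -> isotropy (sg y) t -> P y t.
Proof.
move=> csg /compact_near_coveringP/(_ _ (nbhs y0)
  (fun y t => isotropy (sg y) t -> P y t)) cC CP.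
have : \forall y \near y0, C `<=` (fun t => isotropy (sg y) t -> P y t).
  apply: cC => t0 Ct0; have [xt|nxt] := pselect (isotropy (sg y0) t0); first exact: CP.
  by apply: filterS (near_not_isotropy csg nxt) => p np /np.
by apply: filterS => y Cy t Ct; exact: Cy.
Qed.

Hypothesis stab_open : forall V : set G, open V -> open (r @` (V `&` stab r s)).

(** Openness of the range map of the stability groupoid, in the form in which it is used: an
    isotropy element over [x0] has close neighbours in the isotropy groups of all nearby points. *)
Lemma near_isotropy x0 t0 (A : set G) : isotropy x0 t0 -> nbhs t0 A ->
  \forall x \near x0, exists2 t, A t & isotropy x t.
Proof.
move=> [rt st]; rewrite nbhsE => -[V [oV Vt VA]].
have : nbhs x0 (r @` (V `&` stab r s)).
  apply: open_nbhs_nbhs; split; first exact: stab_open.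
  by exists t0 => //; split => //; rewrite /stab /= st.
by apply: filterS => x [t [Vt' st'] <-]; exists t; [exact: VA|split].
Qed.

(** A piece of [chi] concentrated near an isotropy element [t0] is dominated, on each nearby fibre,
    by a multiple of a translate of [F] by an isotropy element close to [t0]; invariance removes the
    translation. Finitely many pieces make up [chi]. *)
Lemma fib_bounded x0 (chi F : G -> R) : Cplus chi -> Cplus F -> 0 < F (e x0) ->
  exists2 M, 0 <= M & \forall x \near x0, fib x chi <= M * fib x F.
Proof.
move=> Cchi CF Fe; have [cF F0 _] := CF.
pose P (t0 : G) (A : set G) := nbhs t0 A /\ forall b, Cplus b -> (forall t, ~ A t -> b
  t = 0) ->
  exists2 M, 0 <= M & \forall x \near x0, fib x b <= M * fib x F.
have /choice[U HU] : forall t0, exists A, P t0 A.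
  move=> t0; have [xt|nxt] := pselect (isotropy x0 t0); last first.
    have [A tA [N xN AN]] : exists2 A, nbhs t0 A & exists2 N, nbhs x0 N &
        forall t x, A t -> N x -> ~ isotropy x t.
      have [|[A N] /= [tA xN] AN] := @near_not_isotropy X id x0 t0 _ nxt;
        first exact: cvg_id.
      by exists A => //; exists N => // t x At Nx; exact: (AN (t, x)).
    exists A; split => // b Cb bA; exists 0 => //; apply: filterS xN => x Nx.
    rewrite mul0r (@fib_ext x b (fun=> 0)); last first.
      by move=> t xt; apply: bA => At; exact: (AN t x).
    by rewrite fib0.
  have [rt st] := xt; pose et := F (e x0) / 2.
  have et0 : 0 < et by rewrite divr_gt0.
  (* As [m (i t0) t0] is the unit, [F (m (i t) z)] stays above [et] for composable [i t], [z] with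
     [t] and [z] near [t0]; hence the factor [Mb / et] below. *)
  have W : nbhs (m (i t0) t0) [set z | et < F z].
    apply: (cF _ [set z | et < z]); rewrite im st; apply: lt_nbhsr.
    by rewrite ltr_pdivrMr // ltr_pMr // ltr1n.
  have [|A [B [iA tB AB]]] := continuous_composable gG _ W; first by rewrite si.
  have tA : nbhs t0 ((i @^-1` A) `&` B) by apply: filterI => //; exact: iC.
  exists ((i @^-1` A) `&` B); split => // b Cb bA.
  have [Mb Mb0 bM] := Cplus_bounded Cb.
  exists (Mb / et); first by rewrite divr_ge0 // ltW.
  have := near_isotropy xt tA; apply: filterS => x [t [iAt Bt] xt'].
  have xi := isotropy_inv xt'.
  rewrite -(fib_shift xi (Cplus_fibre x CF)) -fibZ; last 2 first.
  - by rewrite divr_ge0 // ltW.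
  - exact: fibre_Cplus_shift (Cplus_fibre x CF).
  apply: fib_le; first exact: Cplus_fibre.
    apply: (@CplusM _ _ (fun=> Mb / et)) => //; first by move=> z;
      exact: cst_continuous.
      by move=> _; rewrite divr_ge0 // ltW.
    exact: (fibre_Cplus_shift xi (Cplus_fibre x CF)).
  move=> z xz; have [[_ Bz]|nz] := pselect (((i @^-1` A) `&` B) z); last first.
    by rewrite bA // mulr_ge0 // divr_ge0 // ltW.
  have /= Fz : et < F (m (i t) z).
    by apply: AB => //; rewrite si; case: xt' => -> _; case: xz.
  by rewrite (le_trans (bM z)) // mulrAC ler_pdivlMr // ler_wpM2l // ltW.
have [_ _ [K cK chiK]] := Cchi.
have [l [h [lK lh chiE]]] := Cplus_decomp lG Cchi cK chiK (fun t _ => (HU t).1).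
have Ch u : u \in l -> Cplus (h u) by move=> /lh[].
have step (l' : seq G) : {subset l' <= l} ->
    exists2 M, 0 <= M & \forall x \near x0, \sum_(u <- l') fib x (h u) <= M * fib x F.
  elim: l' => [|u l' IH] sl'.
    exists 0 => //; apply: nearW => x; by rewrite big_nil mul0r.
  have [|M M0 HM] := IH; first by move=> v vl; apply: sl'; rewrite inE vl orbT.
  have ul : u \in l by apply: sl'; exact: mem_head.
  have [|M' M'0 HM'] := (HU u).2 _ (Ch _ ul).
    by move=> t nU; have [_ _ [C cC [CU hC]]] := lh _ ul; apply: hC => /CU.
  exists (M' + M); first exact: addr_ge0.
  apply: filterS2 HM HM' => x h1 h2; rewrite big_cons mulrDl.
  exact: lerD.
have [M M0 HM] := step l (fun _ h => h); exists M => //.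
apply: filterS HM => x; apply: le_trans.
rewrite (@fib_ext x chi (fun t => \sum_(u <- l | u \in l) h u t)); last first.
  by move=> t _; rewrite chiE big_seq_cond; apply: eq_bigl => u; rewrite andbT.
rewrite fib_sum; last by move=> u /Ch Cu; exact: Cplus_fibre.
by rewrite -big_seq.
Qed.

Lemma fib_close x f g chi d : fibre_Cplus x f -> fibre_Cplus x g -> fibre_Cplus x chi ->
  0 <= d -> (forall t, isotropy x t -> `|f t - g t| <= d * chi t) ->
  `|fib x f - fib x g| <= d * fib x chi.
Proof.
move=> Cf Cg Cc d0 fg; have Cdc : fibre_Cplus x (fun t => d * chi t) by exact: CplusZ.
rewrite ler_norml -fibZ //; apply/andP; split.
  rewrite lerBrDl lerBlDr -fibD //; apply: fib_le => //; first exact: CplusD.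
  move=> t xt; have := fg t xt; rewrite ler_norml => /andP[h _]; lra.
rewrite lerBlDl -fibD //; apply: fib_le => //; first exact: CplusD.
by move=> t xt; have := fg t xt; rewrite ler_norml => /andP[_ h]; lra.
Qed.

(** [q] extends the translate of [g0] by [p] beyond the fibre over [sg y0]. On a nearby fibre it is
    uniformly close to the translate of [g0] by some isotropy element [s'] near [p], and that
    translate has the same integral as [g0]. *)
Lemma fib_shift_near (Y : topologicalType) (sg : Y -> X) (y0 : Y)
    (g0 q chi : G -> R) (C K' : set G) p d :
  sg @ y0 --> sg y0 -> Cplus g0 -> Cplus q -> Cplus chi -> compact C ->
  (forall t, C t -> chi t = 1) -> isotropy (sg y0) p -> nbhs p K' ->
  (forall s' t, K' s' -> r s' = r t -> ~ C t -> g0 (m (i s') t) = 0) ->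
  (forall t, ~ C t -> q t = 0) ->
  (forall t, isotropy (sg y0) t -> q t = g0 (m (i p) t)) -> 0 < d ->
  \forall y \near y0, `|fib (sg y) q - fib (sg y) g0| <= d * fib (sg y) chi.
Proof.
move=> csg Cg Cq Cc cC chiC xp pK g0C qC qE d0.
have [cg _ _] := Cg; have [cq _ _] := Cq; have [_ chi0 _] := Cc.
pose P (z : Y * G) t := isotropy (sg z.1) z.2 -> `|g0 (m (i z.2) t) - q t| <= d.
(* The translating element joins the parameter: [tube] runs over [Y * G], and the estimate becomes
   uniform in [s'] near [p]. *)
have : \forall z \near (y0, p), forall t, C t -> isotropy (sg z.1) t -> P z t.
  apply: (@tube _ (sg \o fst) (y0, p)) => //.
    by apply: (cvg_comp fst sg); [exact: cvg_fst|exact: csg].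
  move=> t0 Ct0 xt0 /=; have d2 : 0 < d / 2 by rewrite divr_gt0.
  have ipt0 : s (i p) = r t0 by rewrite si; case: xp => ->; case: xt0.
  have W1 : nbhs (m (i p) t0) [set z | `|g0 z - g0 (m (i p) t0)| < d / 2].
    have /cvgrPdist_lt/(_ _ d2) := cg (m (i p) t0).
    by apply: filterS => z; rewrite distrC.
  have W2 : nbhs t0 [set z | `|q z - q t0| < d / 2].
    have /cvgrPdist_lt/(_ _ d2) := cq t0.
    by apply: filterS => z; rewrite distrC.
  have [A [B [iA tB AB]]] := continuous_composable gG ipt0 W1.
  exists (B `&` [set z | `|q z - q t0| < d / 2], [set z : Y * G | A (i z.2)]).
    split => /=; first exact: filterI.
    exists (setT, i @^-1` A); first by split; [exact: filterT|exact: iC].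
    by move=> z [_ /=].
  move=> [t [y s']] /= [[Bt qt] As'] xt xs'.
  have : `|g0 (m (i s') t) - g0 (m (i p) t0)| < d / 2.
    by apply: AB => //; rewrite si; case: xs' => ->; case: xt.
  rewrite -(qE t0 xt0) => g1; rewrite -[_ - _](subrKA (q t0)) [d]splitr.
  by rewrite (le_trans (ler_normD _ _)) // lerD // ltW // distrC.
move=> [[B A] /= [yB pA] BA].
have xA : \forall x \near sg y0, exists2 t, (A `&` K') t & isotropy x t.
  by apply: (near_isotropy xp); exact: filterI.
have yA := csg _ xA; apply: filterS2 yB yA => y By /= [s' [As' Ks'] xs'].
have xi := isotropy_inv xs'.
rewrite -(fib_shift xi (Cplus_fibre _ Cg)).
apply: fib_close; try exact: Cplus_fibre; try exact: ltW.
  exact: fibre_Cplus_shift (Cplus_fibre _ Cg).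
move=> t xt; rewrite distrC; have [Ct|nC] := pselect (C t).
  by rewrite chiC // mulr1; apply: (BA (y, s') _ t Ct xt xs').
rewrite qC // g0C // ?subrr ?normr0 ?mulr_ge0 // ?ltW //.
by case: xs' => ->; case: xt.
Qed.

(** The product [m (i p) t] is meaningful only for [t] with range [x0], so the translate is extended
    to [G] from the closed set [isotropy x0] by Tietze. *)
Lemma shift_extend x0 p (g0 : G -> R) (C1 C : set G) : isotropy x0 p -> Cplus g0 ->
  compact C1 -> compact C -> C1 `<=` C° ->
  (forall t, isotropy x0 t -> ~ C1 t -> g0 (m (i p) t) = 0) ->
  exists q, [/\ Cplus q, forall t, ~ C t -> q t = 0 &
    forall t, isotropy x0 t -> q t = g0 (m (i p) t)].
Proof.
move=> xp Cg cC1 cC C1C gC1; have [cg g00 _] := Cg.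
have cf : {within isotropy x0, continuous (fun t => g0 (m (i p) t))}.
  apply/subspace_continuousP => t0 xt0 W gW.
  have W1 : nbhs (m (i p) t0) (g0 @^-1` W) by exact: cg.
  have [|A [B [iA tB AB]]] := continuous_composable gG _ W1.
    by rewrite si; case: xp => ->; case: xt0.
  rewrite /= !nbhs_simpl /within /=; apply: filterS tB => t Bt xt.
  apply: AB => //; first exact: nbhs_singleton.
  by rewrite si; case: xp => ->; case: xt.
have [g [cgg gE _]] := lch_tietze lG (@closed_isotropy x0) cC1 cf gC1.
have [b [Cb _ b1 [D cD [DC bD]]]] := @lch_bump R G C1 _ lG cC1 (@open_interior _ C) C1C.
(* The absolute value restores nonnegativity and [b] confines the support to [C]; neither changes
   the values on the fibre, where the translate is nonnegative and is 0 off [C1]. *)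
exists (fun t => `|g t| * b t); split.
- apply: CplusM => // t; apply: continuous_comp; first exact: cgg.
  exact: norm_continuous.
- by move=> t nC; rewrite bD ?mulr0 // => /DC /interior_subset.
- move=> t xt; rewrite gE // ger0_norm //.
  by have [C1t|nC1] := pselect (C1 t); [rewrite b1 ?mulr1|rewrite gC1 // mul0r].
Qed.

(** Joint continuity at the points over [y0], tested along isotropy elements only, since [k y]
    matters on the fibre over [sg y] alone. *)
Definition fibre_continuous (Y : topologicalType) (sg : Y -> X) (y0 : Y)
    (k : Y -> G -> R) : Prop :=
  forall t0 d, isotropy (sg y0) t0 -> 0 < d ->
    \forall t \near t0 & y \near y0, isotropy (sg y) t -> `|k y t - k y0 t0| < d.

(** Each translate is replaced by its extension [q p]. Their combination [Q] is compared with [k y]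
    by [tube], at the cost of [2 * d], and [fib_shift_near] evaluates the integrals of the [q p]
    with total error [d]; hence the factor 3. *)
Lemma fib_transfer (Y : topologicalType) (sg : Y -> X) (y0 : Y) (k : Y -> G -> R)
    (K K' C1 C : set G) (g0 chi : G -> R) (l : seq (R * G)) d :
  sg @ y0 --> sg y0 -> (forall y, fibre_Cplus (sg y) (k y)) ->
  (\forall y \near y0, forall t, isotropy (sg y) t -> ~ K t -> k y t = 0) ->
  fibre_continuous sg y0 k -> Cplus g0 -> Cplus chi ->
  compact C1 -> compact C -> C1 `<=` C° -> K `<=` C -> (forall t, C t -> chi t = 1) ->
  (forall s' t, K' s' -> r s' = r t -> ~ C1 t -> g0 (m (i s') t) = 0) ->
  (forall p, p \in l -> [/\ 0 <= p.1, isotropy (sg y0) p.2 & nbhs p.2 K']) -> 0 < d ->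
  (forall t, isotropy (sg y0) t ->
     `|k y0 t - \sum_(p <- l) p.1 * g0 (m (i p.2) t)| <= d) ->
  \forall y \near y0,
    `|fib (sg y) (k y) - (\sum_(p <- l) p.1) * fib (sg y) g0| <= 3 * d * fib (sg y) chi.
Proof.
move=> csg Ck kK ck Cg Cc cC1 cC C1C KC chiC gK lP d0 kd; have [_ chi0 _] := Cc.
have C1C' : C1 `<=` C by exact: subset_trans (@interior_subset _ _).
have /choice[q Hq] : forall p : R * G, exists q : G -> R, p \in l -> [/\ Cplus q,
    forall t, ~ C t -> q t = 0 & forall t, isotropy (sg y0) t -> q t = g0 (m (i p.2)
      t)].
  move=> p; have [pl|npl] := boolP (p \in l); last by exists (fun=> 0).
  have [_ xp pK'] := lP _ pl.
  have [|q Hq] := shift_extend xp Cg cC1 cC C1C; last by exists q.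
  move=> t xt nC1; apply: gK => //; first exact: nbhs_singleton.
  by case: xp => ->; case: xt.
pose Q t := \sum_(p <- l | p \in l) p.1 * q p t.
have Cp p : p \in l -> Cplus (fun t => p.1 * q p t).
  by move=> pl; have [p0 _ _] := lP _ pl; apply: CplusZ => //; case: (Hq _ pl).
have CQ : Cplus Q by apply: Cplus_sum.
have QE t : isotropy (sg y0) t -> Q t = \sum_(p <- l) p.1 * g0 (m (i p.2) t).
  move=> xt; rewrite [RHS]big_seq_cond /Q; apply: eq_big => p; first by rewrite andbT.
  by move=> pl; case: (Hq _ pl) => _ _ ->.
have [cQ _ _] := CQ.
have near1 : \forall y \near y0, forall t, C t -> isotropy (sg y) t -> `|k y t - Q t|
  <= 2 * d.
  apply: tube => // t0 Ct0 xt0; have d2 : 0 < d / 2 by rewrite divr_gt0.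
  have [[A B] /= [tA yB] AB] := ck _ _ xt0 d2.
  have W2 : nbhs t0 [set z | `|Q z - Q t0| < d / 2].
    have /cvgrPdist_lt/(_ _ d2) := cQ t0.
    by apply: filterS => z; rewrite distrC.
  exists (A `&` [set z | `|Q z - Q t0| < d / 2], B).
    by split => //; exact: filterI.
  move=> [t y] /= [[At /ltW h1] By] xt; have /ltW h2 := AB (t, y) (conj At By) xt.
  have h3 := kd _ xt0; rewrite -QE // in h3.
  rewrite /= in h2; move: h1 h2 h3;
    rewrite !ler_norml => /andP[a1 a2] /andP[b1 b2] /andP[c1 c2].
  by apply/andP; split; lra.
have S0 : 0 <= \sum_(p <- l) p.1.
  by rewrite big_seq_cond; apply: sumr_ge0 => p; rewrite andbT => /lP[].
(* The error [d] is shared among the terms in proportion to their coefficients; the 1 avoids a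
   division by 0. *)
pose d' := d / (\sum_(p <- l) p.1 + 1).
have S1 : 0 < \sum_(p <- l) p.1 + 1 by rewrite ltr_wpDl.
have d'0 : 0 < d' by rewrite divr_gt0.
have near2 (l' : seq (R * G)) : {subset l' <= l} -> \forall y \near y0,
    `|\sum_(p <- l') p.1 * fib (sg y) (q p) - (\sum_(p <- l') p.1) * fib (sg y) g0| <=
    (\sum_(p <- l') p.1) * (d' * fib (sg y) chi).
  elim: l' => [|p l' IH] sl'.
    by apply: nearW => y; rewrite !big_nil !mul0r subrr normr0.
  have pl : p \in l by apply: sl'; exact: mem_head.
  have {}IH := IH (fun z zl => sl' z (@mem_behead _ (p :: l') z zl)).
  have [Cqp qC qE] := Hq _ pl; have [p0 xp pK'] := lP _ pl.
  have := fib_shift_near csg Cg Cqp Cc cC chiC xp pK'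
    (fun s' t ks rs nC => gK s' t ks rs (fun c => nC (C1C' t c))) qC qE d'0.
  apply: filterS2 IH => y h1 h2; rewrite !big_cons !mulrDl opprD addrACA.
  rewrite (le_trans (ler_normD _ _)) // lerD // -mulrBr normrM ger0_norm //.
  exact: ler_wpM2l.
have := near2 l (fun _ h => h); apply: filterS3 near1 kK => y h1 h2 h3.
have h4 : `|fib (sg y) (k y) - fib (sg y) Q| <= 2 * d * fib (sg y) chi.
  apply: fib_close => //; try exact: Cplus_fibre; first by rewrite mulr_ge0 // ltW.
  move=> t xt; have [Ct|nC] := pselect (C t); first by rewrite chiC // mulr1 h1.
  rewrite h2 //; last by move=> /KC.
  rewrite /Q big1 => [|p pl]; first by rewrite subrr normr0 mulr_ge0 // mulr_ge0 // ltW.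
  by case: (Hq _ pl) => _ -> //; rewrite mulr0.
have QfE : fib (sg y) Q = \sum_(p <- l) p.1 * fib (sg y) (q p).
  rewrite fib_sum => [|p pl]; last by apply: Cplus_fibre; exact: Cp.
  rewrite [RHS]big_seq_cond; apply: eq_big => p; first by rewrite andbT.
  move=> pl; rewrite fibZ //; first by case: (lP _ pl).
  by apply: Cplus_fibre; case: (Hq _ pl).
have h5 : (\sum_(p <- l) p.1) * (d' * fib (sg y) chi) <= d * fib (sg y) chi.
  rewrite mulrA ler_wpM2r ?fib_ge0 //; first exact: Cplus_fibre.
  by rewrite /d' mulrCA ler_piMr ?(ltW d0) // ler_pdivrMr // mul1r lerDl.
rewrite -[_ - _](subrKA (fib (sg y) Q)) (le_trans (ler_normD _ _)) //.
rewrite (_ : 3 * d = 2 * d + d); last by ring.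
by rewrite mulrDl lerD // QfE (le_trans h3).
Qed.

(* Near [e x0], both [k y0] and [F] are approximated on [isotropy x0] by linear
   combinations of left translates of one function [g0] concentrated near
   [e x0]; translating by nearby elements of the neighbouring isotropy groups
   transfers both approximations, and the common factor [fib x g0] cancels in
   the quotient. *)
Lemma fib_ratio_continuous (Y : topologicalType) (sg : Y -> X) (y0 : Y)
    (k : Y -> G -> R) (K : set G) (F : G -> R) :
  sg @ y0 --> sg y0 -> (forall y, fibre_Cplus (sg y) (k y)) -> compact K ->
  (\forall y \near y0, forall t, isotropy (sg y) t -> ~ K t -> k y t = 0) ->
  fibre_continuous sg y0 k -> Cplus F -> 0 < F (e (sg y0)) ->
  (fun y => fib (sg y) (k y) / fib (sg y) F) @ y0 -->
    fib (sg y0) (k y0) / fib (sg y0) F.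
Proof.
move=> csg Ck cK kK ck CF Fe; set x0 := sg y0.
have [cF F0 [KF cKF FK]] := CF.
have hG := lG.2.
pose K2 := K `|` KF; have cK2 : compact K2 by exact: compactU.
have [K' cK' [_ K2K']] := compact_nbhs_compact lG cK2 openT (fun _ _ => I).
have [V0 cV0 [_ eV0]] := lch_nbhs_compact lG (filterT : nbhs (e x0) setT).
(* [g0] will be supported in [V0], so the products of [K'] and [V0] contain the support of each of
   its translates by elements of [K']. *)
pose C1 := [set m p.1 p.2 | p in (K' `*` V0) `&` composable r s] `|` K2.
have cC1 : compact C1 by apply: compactU => //; exact: (compact_composable gG).
have [C cC [_ C1C]] := compact_nbhs_compact lG cC1 openT (fun _ _ => I).
have C1C' : C1 `<=` C by exact: subset_trans (@interior_subset _ _).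
have [chi [Cchi _ chiC _]] := @lch_bump R G C _ lG cC openT (fun _ _ => I).
have [M M0 HM] := fib_bounded Cchi CF Fe.
have Fpos y : 0 < F (e (sg y)) -> 0 < fib (sg y) F.
  by move=> Fy; apply: fib_gt0; [exact: Cplus_fibre|exists (e (sg y)) => //;
    exact: isotropy_id].
have [HL iL sL] := hL x0.
set a1 := fib x0 (k y0); set a2 := fib x0 F.
have a2p : 0 < a2 by exact: Fpos.
have a10 : 0 <= a1 by apply: fib_ge0; exact: Ck.
have gG' := isotropy_lc_group x0.
have cK2' : compact (set_val @^-1` K2 : set (isotropy x0)).
  by apply: closed_set_val_compact => //; exact: closed_isotropy.
apply/cvgrPdist_le => eps eps0.
(* The final error, relative to [fib (sg y) F], is [3 * eta * M * (1 + a1 / a2)]; [M + 1] replaces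
   [M], which may be 0. *)
pose eta := eps / (3 * (M + 1) * (1 + a1 / a2)).
have D0 : 0 < 3 * (M + 1) * (1 + a1 / a2).
  apply: mulr_gt0; first by rewrite mulr_gt0 // ltr_wpDl.
  by rewrite ltr_wpDr // divr_ge0 // ltW.
have eta0 : 0 < eta by rewrite divr_gt0.
have kK0 (t : isotropy x0) : ~ (set_val @^-1` K2) t -> k y0 (set_val t) = 0.
  move=> nK; apply: (nbhs_singleton kK); first exact: set_valP.
  by move=> Kt; apply: nK; left.
have FK0 (t : isotropy x0) : ~ (set_val @^-1` K2) t -> F (set_val t) = 0.
  by move=> nK; apply: FK => Kt; apply: nK; right.
have [V1 oV1 HV1] := haar_approx gG' HL iL sL (Ck y0) cK2' kK0 eta0.
have [V2 oV2 HV2] := haar_approx gG' HL iL sL (Cplus_fibre x0 CF) cK2' FK0 eta0.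
(* A single [g0] must serve both approximations, so that the same [kap] and the same [fib (sg y) g0]
   occur in them. *)
have [_ [[W oW <-] /= We WV]] := filterI oV1 oV2.
have eW : nbhs (e x0) (W `&` V0) by apply: filterI => //; exact: open_nbhs_nbhs.
have [g0 [Cg _ ge [Cg' cCg' [CgW gC]]]] := @lch_bump_pt R G _ _ lG eW.
have Bg : bump (fun t : isotropy x0 => g0 (set_val t)).
  by split; [exact: Cplus_fibre|exists (iso_id x0); rewrite /= ge].
have gV (V : set (isotropy x0)) : V1 `&` V2 `<=` V ->
    forall t : isotropy x0, ~ V t -> g0 (set_val t) = 0.
  by move=> VV t nV; apply: gC => /CgW[Wt _]; apply: nV; apply: VV; exact: WV.
have [l1 [l1P l1S l1E]] := HV1 _ Bg (gV _ (@subIsetl _ _ _)).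
have [l2 [l2P l2S l2E]] := HV2 _ Bg (gV _ (@subIsetr _ _ _)).
have gK s' t : K' s' -> r s' = r t -> ~ C1 t -> g0 (m (i s') t) = 0.
  move=> Ks rst nC1; apply: gC => /CgW[_ Vt]; apply: nC1; left.
  exists (s', m (i s') t); last by rewrite /= (groupoid_mulK gG).
  by split => //; rewrite /composable /= rM ?ri ?si.
pose up (l : seq (R * isotropy x0)) := [seq (p.1, set_val p.2) | p <- l].
have upP l : (forall p, p \in l -> 0 <= p.1 /\ (set_val @^-1` K2) p.2) ->
    forall p, p \in up l -> [/\ 0 <= p.1, isotropy (sg y0) p.2 & nbhs p.2 K'].
  move=> lP _ /mapP[p pl ->] /=; have [p0 Kp] := lP _ pl.
  split => //; [exact: set_valP|exact: K2K'].
have upS l : \sum_(p <- up l) p.1 = \sum_(p <- l) p.1 by rewrite big_map.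
have upE l f : (forall t : isotropy x0, `|f (set_val t) -
      \sum_(p <- l) p.1 * g0 (set_val (iso_mul (iso_inv p.2) t))| <= eta) ->
    forall t, isotropy (sg y0) t ->
      `|f t - \sum_(p <- up l) p.1 * g0 (m (i p.2) t)| <= eta.
  move=> fl t xt; rewrite big_map.
  exact: (fl (exist (fun g => g \in isotropy x0) t (mem_set xt))).
have KC : K `<=` C by move=> t Kt; apply: C1C'; right; left.
have KFC : KF `<=` C by move=> t Kt; apply: C1C'; right; right.
have T1 := fib_transfer csg Ck kK ck Cg Cchi cC1 cC C1C KC chiC gK (upP _ l1P) eta0
  (upE _ _ l1E).
have T2 : \forall y \near y0, `|fib (sg y) F - (\sum_(p <- up l2) p.1) * fib (sg y)
  g0| <=
    3 * eta * fib (sg y) chi.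
  apply: (@fib_transfer _ sg y0 (fun=> F) KF K' C1 C g0 chi (up l2) eta) => //.
  - by move=> y; exact: Cplus_fibre.
  - by apply: nearW => y t _; exact: FK.
  - move=> t0 d xt0 d0; have /cvgrPdist_lt/(_ _ d0) := cF t0 => Ft0.
    exists ([set t | `|F t0 - F t| < d], setT); first by split => //; exact: filterT.
    by move=> [t y] /= [Ft _] _; rewrite distrC.
  - exact: upP.
  - exact: (upE _ F).
have cFe : \forall y \near y0, 0 < F (e (sg y)).
  have cFe : F (e (sg y)) @[y --> y0] --> F (e (sg y0)).
    by apply: (cvg_comp sg (F \o e)); [exact: csg|apply: continuous_comp;
      [exact: eC|exact: cF]].
  by apply: (cFe [set z | 0 < z]); exact: lt_nbhsr.
have HM' : \forall y \near y0, fib (sg y) chi <= M * fib (sg y) F by exact: (csg _ HM).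
apply: filterS2 (filterI T1 T2) (filterI cFe HM') => y /= [h1 h2] [h3 h4].
have Bp := Fpos _ h3.
move: h1 h2; rewrite !upS l1S l2S -/(fib x0 (k y0)) -/(fib x0 F) -/a1 -/a2.
set kap := L _; set A := fib (sg y) (k y); set B := fib (sg y) F in h4 Bp *.
set g := fib (sg y) g0 => h1 h2.
have e3 : 0 <= 3 * eta by rewrite mulr_ge0 // ltW.
have h5 := ler_wpM2l e3 h4.
have {}h1 := le_trans h1 h5; have {}h2 := le_trans h2 h5.
have a12 : 0 <= a1 / a2 by rewrite divr_ge0 // ltW.
have h6 : `|a1 / a2 * B - A| <= (1 + a1 / a2) * (3 * eta * (M * B)).
  (* The uncontrolled value [g] cancels, because [a1 / a2 * (a2 / kap) = a1 / kap]. *)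
  have -> : a1 / a2 * B - A = a1 / a2 * (B - a2 / kap * g) - (A - a1 / kap * g).
    rewrite mulrBr mulrA [a1 / a2 * (a2 / kap)]mulrA divfK ?gt_eqF //; ring.
  rewrite (le_trans (ler_normB _ _)) // normrM ger0_norm // mulrDl mul1r addrC.
  by rewrite lerD // ler_wpM2l.
rewrite -(ler_pM2r Bp) -[X in _ * X](ger0_norm (ltW Bp)) -normrM mulrBl divfK ?gt_eqF
  //.
rewrite (le_trans h6) // mulrA mulrA ler_pM2r // /eta.
have M1 : M + 1 != 0 by rewrite gt_eqF // ltr_wpDl.
have q1 : 1 + a1 / a2 != 0 by rewrite gt_eqF // ltr_wpDr.
rewrite (_ : _ * M = eps * (M / (M + 1))); last first.
  by move: (a1 / a2) q1 => q q1; field; rewrite q1 M1.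
by rewrite ler_piMr ?(ltW eps0) // ler_pdivrMr ?ltr_wpDl // mul1r lerDl.
Qed.

End HaarFamily.
End Isotropy.

(* The supports [W j] of the bumps stay locally finite because [W j] meets the
   compact set [closure (V k)] only if [closure (V j)] does. *)
Lemma paracompact_bumps (R : realType) (X : topologicalType) (A : X -> set X) :
  lch_space X -> paracompact X -> (forall x : X, nbhs x (A x)) ->
  exists (J : choiceType) (p : J -> X) (u : J -> X -> R),
    [/\ forall j, Cplus (u j),
        forall x : X, exists2 N, nbhs x N & exists2 D : seq J, uniq D &
          forall y j, N y -> j \notin D -> u j y = 0 &
        forall x : X, exists2 j, A (p j) x & 0 < u j x].
Proof.
move=> lX pX xA; have hX := lX.2.
have /choice[C HC] : forall x : X, exists C, [/\ compact C, C `<=` A x & nbhs x C].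
  by move=> x; have [C cC [CA xC]] := lch_nbhs_compact lX (xA x); exists C.
have [||J0 [V0 [oV0 V0T V0C V0f]]] := pX X (fun x => (C x)°).
- by move=> x; exact: open_interior.
- by apply/seteqP; split => // x _; exists x => //; case: (HC x).
pose J : choiceType := {classic J0}; pose V : J -> set X := V0.
have {}oV (j : J) : open (V j) by exact: oV0.
have VT (x : X) : exists j : J, V j x.
  by have [j _ Vj] : (\bigcup_j V0 j) x by [rewrite V0T]; exists j.
have {}Vf (x : X) : exists2 N, nbhs x N & finite_set [set j : J | V j `&` N !=set0].
  by have [N [xN fN]] := V0f x; exists N.
have /choice[p VC] : forall j : J, exists x, V j `<=` (C x)° by exact: V0C.
pose K (j : J) := closure (V j).
have KC j : K j `<=` C (p j).
  have [cC _ _] := HC (p j); rewrite [C _](closure_id _).1; last exact: compact_closed.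
  by apply: closureS; apply: subset_trans (VC j) _; exact: interior_subset.
have cK j : compact (K j).
  have [cC _ _] := HC (p j); apply: (subclosed_compact _ cC (KC j));
    exact: closed_closure.
have Kf (x : X) : exists2 N, nbhs x N & finite_set [set j : J | K j `&` N !=set0].
  have [N xN fN] := Vf x; exists N°; first exact: nbhs_interior.
  apply: sub_finite_set fN => j [y [Ky Ny]].
  have [z [Vz Nz]] := Ky _ (nbhs_interior Ny).
  by exists z; split => //; exact: interior_subset.
have Kc (L : set X) : compact L -> finite_set [set j : J | K j `&` L !=set0].
  move=> cL; have /choice[N HN] : forall x : X, exists N,
      nbhs x N /\ finite_set [set j : J | K j `&` N !=set0].
    by move=> x; have [N ? ?] := Kf x; exists N.
  have [s [_ sL]] := compact_finite_cover cL (fun x _ => (HN x).1).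
  apply: (@sub_finite_set _ _ (\bigcup_(x in [set` s]) [set j : J | K j `&` N x
    !=set0])).
    move=> j [y [Ky Ly]]; have [x xs Nx] := sL _ Ly.
    by exists x => //; exists y.
  by apply: bigcup_finite => // x _; case: (HN x).
pose W j := ~` (\bigcup_(k in [set k | K k `&` K j = set0]) K k).
have oW j : open (W j).
  apply: closed_openC; rewrite -[X in closed X]setCK; apply: open_closedC.
  rewrite openE => x nKx; rewrite /interior.
  have [N xN fN] := Kf x.
  (* Near [x] only these finitely many sets of the union can be met, and a finite union of closed
     sets is closed. *)
  pose D := [set k | K k `&` K j = set0] `&` [set k : J | K k `&` N !=set0].
  have cD : closed (\bigcup_(k in D) K k).
    apply: closed_bigcup; last by move=> k _; exact: closed_closure.
    exact: finite_setIr.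
  have xD : nbhs x (~` \bigcup_(k in D) K k).
    apply: open_nbhs_nbhs; split; first exact: closed_openC.
    by move=> [k [Dk _] Kx]; apply: nKx; exists k.
  apply: filterS (filterI xN xD) => y [Ny nD] [k Dk Ky]; apply: nD.
  by exists k => //; split => //; exists y.
have KW j : K j `<=` W j.
  move=> x Kjx [k kj Kkx]; have : (K k `&` K j) x by [].
  by rewrite kj.
have /choice[u Hu] : forall j, exists u : X -> R, [/\ Cplus u,
    forall x, K j x -> u x = 1 & forall x, ~ W j x -> u x = 0].
  move=> j; have [u [Cu _ u1 [D cD [DW uD]]]] := @lch_bump R X _ _ lX (cK j) (oW j)
    (KW j).
  by exists u; split => // x nW; apply: uD => /DW.
exists J, p, u; split.
- by move=> j; case: (Hu j).
- move=> x; have [k Vkx] := VT x; exists (V k).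
    by apply: open_nbhs_nbhs.
  have /finite_fsetP[D DE] := Kc _ (cK k).
  exists (finmap.enum_fset D); first exact: finmap.fset_uniq.
  move=> y j Vy jD; have [_ _ ->//] := Hu j.
  apply; exists k; last exact: subset_closure.
  rewrite /= setIC; apply: contrapT => /eqP/set0P ne.
  have : [set j : J | K j `&` K k !=set0] j by [].
  by rewrite DE /= => jD'; rewrite jD' in jD.
- move=> x; have [k Vkx] := VT x; exists k.
    have [_ CA _] := HC (p k); apply: CA; apply: KC; exact: subset_closure.
  have [_ h _] := Hu k; rewrite h ?ltr01 //; exact: subset_closure.
Qed.

Section IsotropyHaar.
Context {R : realType} {G X : topologicalType}.
Variables (r s : G -> X) (e : X -> G) (m : G -> G -> G) (i : G -> G).
Hypothesis gG : is_locally_compact_groupoid r s e m i.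
Hypothesis pX : paracompact X.
Hypothesis stab_open : forall V : set G, open V -> open (r @` (V `&` stab r s)).

Let rC := continuous_range gG.
Let eC := continuous_unit gG.
Let re := range_unit gG.

(** [F] need not have compact support, but over a neighbourhood of each base point it coincides with
    a function that has. The factors [u j (r g)] make the sum locally finite along [r], and at each
    unit some term is positive. *)
Lemma normalizer_exists : exists F : G -> R, forall x0, exists2 N, nbhs x0 N &
  exists F0, [/\ Cplus F0, 0 < F0 (e x0) & forall g, N (r g) -> F g = F0 g].
Proof.
have lG := lc_lchG gG; have lX := lc_lchX gG.
have /choice[b Hb] : forall x, exists b : G -> R, Cplus b /\ b (e x) = 1.
  move=> x; have [b [Cb _ bx _]] := @lch_bump_pt R G (e x) setT lG filterT.
  by exists b.
have [|J [p [u [Cu uf up]]]] :=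
    @paracompact_bumps R X (fun x => [set y | 0 < b x (e y)]) lX pX.
  move=> x; have [[cb _ _] bx] := Hb x.
  have : continuous (b x \o e).
    by move=> z; apply: continuous_comp; [exact: eC|exact: cb].
  by move=> /(_ x [set z | 0 < z]); apply; apply: lt_nbhsr; rewrite /= bx.
pose w j g := u j (r g) * b (p j) g.
have Cw j : Cplus (w j).
  have [cu u0 _] := Cu j; apply: CplusM => //; last by case: (Hb (p j)).
  by move=> g; apply: continuous_comp; [exact: rC|exact: cu].
(* Such a sum is 0 by convention when infinitely many terms are nonzero; local finiteness rules that
   out. *)
exists (fun g => \sum_(j \in [set: J]) w j g) => x0.
have [N xN [D uD ND]] := uf x0; exists N => //.
have [j0 jx ujx] := up x0.
have jD : j0 \in D.
  by apply/negPn/negP => nD; move: ujx; rewrite ND ?ltxx //; exact: nbhs_singleton.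
exists (fun g => \sum_(j <- D) w j g); split.
- exact: Cplus_sum.
- have w0 j g : 0 <= w j g by case: (Cw j).
  rewrite (big_rem j0) //= ltr_wpDr //; first exact: sumr_ge0.
  by rewrite /w re mulr_gt0.
- move=> g Ng; rewrite (@fsbigE _ _ _ _ _ D) //.
    by apply: eq_bigl => j; rewrite in_setT.
  by move=> j _ nD; rewrite /w ND // mul0r.
Qed.

Definition invariant_family (I : X -> (G -> R) -> R) : Prop :=
  forall x, [/\
    forall f, fibre_Cplus r s x f -> 0 <= I x f,
    forall f g, fibre_Cplus r s x f -> fibre_Cplus r s x g ->
      I x (fun t => f t + g t) = I x f + I x g,
    forall a f, 0 <= a -> fibre_Cplus r s x f -> I x (fun t => a * f t) = a * I x f,
    forall h f, isotropy r s x h -> fibre_Cplus r s x f ->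
      I x (fun t => f (m h t)) = I x f &
    forall f, fibre_Cplus r s x f -> (exists2 t, isotropy r s x t & 0 < f t) -> 0 < I
      x f].

Definition local_family (I : X -> (G -> R) -> R) : Prop :=
  forall x f g, (forall t, isotropy r s x t -> f t = g t) -> I x f = I x g.

(** The parameter space [Y] is arbitrary so that it can later be [G] itself, with the source map as
    [sg]. *)
Definition continuous_family (I : X -> (G -> R) -> R) : Prop :=
  forall (Y : topologicalType) (sg : Y -> X) (y0 : Y) (k : Y -> G -> R) (K : set G),
  sg @ y0 --> sg y0 -> (forall y, fibre_Cplus r s (sg y) (k y)) -> compact K ->
  (\forall y \near y0, forall t, isotropy r s (sg y) t -> ~ K t -> k y t = 0) ->
  fibre_continuous r s sg y0 k -> (fun y => I (sg y) (k y)) @ y0 --> I (sg y0) (k y0).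

(** Dividing by the integral of the normaliser removes the arbitrary scale on each fibre; near each
    point the normaliser agrees with a member of [Cplus], so continuity of quotients applies. *)
Lemma isotropy_haar_exists : exists I,
  [/\ invariant_family I, local_family I & continuous_family I].
Proof.
have [L hL] := haar_family_exists (R := R) gG; have [F HF] := normalizer_exists.
have CF x : fibre_Cplus r s x F /\ 0 < fib L x F.
  have [N xN [F0 [CF0 F0e FE]]] := HF x.
  have FE' t : isotropy r s x t -> F0 t = F t.
    by move=> [rt st]; rewrite FE // rt; exact: nbhs_singleton.
  split; first exact: fibre_Cplus_ext FE' (Cplus_fibre gG x CF0).
  rewrite -(fib_ext L FE'); apply: (fib_gt0 hL); first exact: (Cplus_fibre gG x CF0).
  by exists (e x) => //; exact: isotropy_id gG x.
have F0 x : 0 <= (fib L x F)^-1 by rewrite invr_ge0 ltW //; have [] := CF x.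
exists (fun x f => fib L x f / fib L x F); split.
- move=> x; split.
  + by move=> f Cf; rewrite mulr_ge0 // (fib_ge0 hL).
  + by move=> f g Cf Cg; rewrite (fibD hL) // mulrDl.
  + by move=> a f a0 Cf; rewrite (fibZ hL) // mulrA.
  + by move=> h f xh Cf; rewrite (fib_shift hL).
  + move=> f Cf fp; apply: divr_gt0; last by have [] := CF x.
    exact: (fib_gt0 hL).
- by move=> x f g fg; rewrite (fib_ext L fg).
- move=> Y sg y0 k K csg Ck cK kK ck.
  have [N xN [F1 [CF1 F1e FE]]] := HF (sg y0).
  have FE' y : N (sg y) -> fib L (sg y) F = fib L (sg y) F1.
    by move=> Ny; apply: fib_ext => t [rt _]; rewrite FE // rt.
  have := fib_ratio_continuous hL stab_open csg Ck cK kK ck CF1 F1e.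
  rewrite -FE'; last exact: nbhs_singleton.
  apply: cvg_trans; apply: near_eq_cvg.
  have yN : \forall y \near y0, N (sg y) by exact: (csg _ xN).
  by apply: filterS yN => y Ny; rewrite /= FE'.
Qed.

End IsotropyHaar.

(** * The quotient groupoid *)

Section Quotient.
Context {G : ptopologicalType} {X : topologicalType}.
Variables (r s : G -> X) (e : X -> G) (m : G -> G -> G) (i : G -> G).
Hypothesis gG : is_locally_compact_groupoid r s e m i.
Hypothesis stab_open : forall V : set G, open V -> open (r @` (V `&` stab r s)).

Let rC := continuous_range gG.
Let sC := continuous_source gG.
Let eC := continuous_unit gG.
Let iC := continuous_inverse gG.
Let rM := range_mul gG.
Let sM := source_mul gG.
Let mA := groupoid_mulA gG.
Let re := range_unit gG.
Let se := source_unit gG.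
Let me := mul_unitr gG.
Let ri := range_inv gG.
Let si := source_inv gG.
Let mi := mul_invr gG.

Local Notation pi := (qmap r s).
Local Notation "[r] q" := (qr r s q) (at level 10).
Local Notation "[s] q" := (qs r s q) (at level 10).

Lemma qmap_eq g h : r g = r h -> s g = s h -> pi g = pi h.
Proof. by move=> rgh sgh; apply/eqmodP; rewrite /= /gsim rgh sgh !eqxx. Qed.

Lemma qmapK q : pi (repr q) = q. Proof. exact: reprK. Qed.

Lemma qmap_inj g h : pi g = pi h -> r g = r h /\ s g = s h.
Proof. by move=> /eqmodP; rewrite /= /gsim => /andP[/eqP ? /eqP]. Qed.

Lemma qr_qmap g : [r] (pi g) = r g.
Proof. by have [] := qmap_inj (qmapK (pi g)). Qed.

Lemma qs_qmap g : [s] (pi g) = s g.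
Proof. by have [] := qmap_inj (qmapK (pi g)). Qed.

Lemma qrs_inj p q : [r] p = [r] q -> [s] p = [s] q -> p = q.
Proof. by move=> rpq spq; rewrite -(qmapK p) -(qmapK q); exact: qmap_eq. Qed.

Lemma continuous_qmap : continuous pi. Proof. exact: pi_continuous. Qed.

Lemma continuous_qr : continuous (qr r s).
Proof.
apply/quotient_continuous; rewrite (_ : _ \o _ = r); first exact: rC.
by apply/funext => g; exact: qr_qmap.
Qed.

Lemma continuous_qs : continuous (qs r s).
Proof.
apply/quotient_continuous; rewrite (_ : _ \o _ = s); first exact: sC.
by apply/funext => g; exact: qs_qmap.
Qed.

(** If [v] in [U] is equivalent to [g0], then [v = m g0 (i h)] with [h] in the isotropy group at
    [s g0]. For [g] near [g0] there is an isotropy element [t] at [s g] close to [h], and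
    [m g (i t)] lies in [U] and is equivalent to [g]. *)
Lemma qmap_open : open_map pi.
Proof.
move=> U oU; change (open (pi @^-1` (pi @` U))).
rewrite openE => g0 /= [v Uv /qmap_inj[rv sv]]; rewrite /interior.
pose h := m (i v) g0.
have vg : s (i v) = r g0 by rewrite si.
have hiso : isotropy r s (s g0) h by split; rewrite /h ?rM ?sM // ri.
have gh : s g0 = r (i h) by rewrite ri; case: hiso => _ ->.
have hE : m g0 (i h) = v.
  have vh : m v h = g0 by exact: (groupoid_mulK gG).
  have rh : r h = s v by rewrite /h rM.
  have sh : s h = r (i h) by rewrite ri.
  have -> : m g0 (i h) = m (m v h) (i h) by rewrite vh.
  by rewrite mA // mi rh me.
have [|A [B [gA hB AB]]] := continuous_composable gG gh (W := U).
  by rewrite hE; exact: open_nbhs_nbhs.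
have : \forall x \near s g0, exists2 t, (i @^-1` B) t & isotropy r s x t.
  by apply: (near_isotropy stab_open hiso); exact: iC.
move=> /sC H; apply: filterS2 gA H => g Ag [t Bt [rt st]].
have git : s g = r (i t) by rewrite ri.
exists (m g (i t)); first exact: AB.
by apply: qmap_eq; [rewrite rM|rewrite sM // si].
Qed.

Lemma qmap_hausdorff : hausdorff_space (Gbar r s).
Proof.
have hX := (lc_lchX gG).2; move=> p q pq; apply: qrs_inj; apply: hX => A B pA qB.
  have [z [Az Bz]] := pq _ _ (continuous_qr pA) (continuous_qr qB).
  by exists ([r] z).
have [z [Az Bz]] := pq _ _ (continuous_qs pA) (continuous_qs qB).
by exists ([s] z).
Qed.

Lemma qmap_lch : lch_space (Gbar r s).
Proof.
split; last exact: qmap_hausdorff.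
move=> q _;
  have [C cC [_ qC]] := lch_nbhs_compact (lc_lchG gG) (filterT : nbhs (repr q) setT).
exists (pi @` C).
  rewrite withinET; rewrite nbhsE; exists (pi @` C°); last by apply: image_subset;
    exact: interior_subset.
  split; first by apply: qmap_open; exact: open_interior.
  by exists (repr q) => //; exact: qmapK.
have cpC : compact (pi @` C).
  by apply: continuous_compact cC; apply: continuous_subspaceT; exact: continuous_qmap.
by split => //; apply: compact_closed => //; exact: qmap_hausdorff.
Qed.

Lemma qr_qm p q : [s] p = [r] q -> [r] (qm r s m p q) = [r] p.
Proof. by move=> pq; rewrite qr_qmap rM. Qed.

Lemma qs_qm p q : [s] p = [r] q -> [s] (qm r s m p q) = [s] q.
Proof. by move=> pq; rewrite qs_qmap sM. Qed.

(** An arrow of the quotient is determined by its range and source ([qrs_inj]), so each equation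
    reduces to comparing endpoints. *)
Lemma quotient_groupoid :
  is_groupoid (qr r s) (qs r s) (qe r s e) (qm r s m) (qi r s i).
Proof.
have qi_r q : [r] (qi r s i q) = [s] q by rewrite qr_qmap ri.
have qi_s q : [s] (qi r s i q) = [r] q by rewrite qs_qmap si.
have qe_r x : [r] (qe r s e x) = x by rewrite qr_qmap re.
have qe_s x : [s] (qe r s e x) = x by rewrite qs_qmap se.
split.
- by move=> a b ab; rewrite qr_qm ?qs_qm.
- by move=> a b c ab bc; apply: qrs_inj; rewrite ?qr_qm ?qs_qm // ?qr_qm ?qs_qm.
- by [].
- by move=> a; split; apply: qrs_inj; rewrite ?qr_qm ?qs_qm ?qe_r ?qe_s.
- move=> a; split=> //; apply: qrs_inj;
  rewrite ?qr_qm ?qs_qm ?qe_r ?qe_s ?qi_r ?qi_s //.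
Qed.

Lemma quotient_lc_groupoid :
  is_locally_compact_groupoid (qr r s) (qs r s) (qe r s e) (qm r s m) (qi r s i).
Proof.
split; [split|exact: qmap_lch|exact: lc_lchX gG].
- exact: quotient_groupoid.
- by split; [exact: continuous_qr|exact: continuous_qs].
- by move=> x; apply: continuous_comp; [exact: eC|exact: continuous_qmap].
- apply/subspace_continuousP => -[p q] /= pq W pqW.
  have pqW' : nbhs (m (repr p) (repr q)) (pi @^-1` W) by exact: continuous_qmap.
  have [A [B [pA qB AB]]] := continuous_composable gG pq pqW'.
  (* A product of quotient maps need not be a quotient map; openness of [pi] is used instead,
     carrying neighbourhoods of representatives to neighbourhoods of classes. *)
  have nbhs_pi (z : Gbar r s) (V : set G) : nbhs (repr z) V -> nbhs z (pi @` V).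
    move=> zV; rewrite nbhsE; exists (pi @` V°).
      split; first by apply: qmap_open; exact: open_interior.
      by exists (repr z); [exact: nbhs_singleton (nbhs_interior zV)|exact: qmapK].
    by apply: image_subset; exact: interior_subset.
  rewrite /= !nbhs_simpl /within /=.
  exists (pi @` A, pi @` B); first by split; exact: nbhs_pi.
  move=> [p' q'] /= [[a Aa ap] [b Bb bq]] pq'.
  have ab : s a = r b by rewrite -qs_qmap -qr_qmap ap bq.
  have := AB a b Aa Bb ab; rewrite /= (_ : pi (m a b) = qm r s m p' q') //.
  by apply: qrs_inj;
    rewrite ?qr_qm ?qs_qm // ?qr_qmap ?qs_qmap ?rM ?sM // -?ap -?bq ?qr_qmap ?qs_qmap.
- apply/quotient_continuous; rewrite (_ : _ \o _ = pi \o i).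
    by move=> g; apply: continuous_comp; [exact: iC|exact: continuous_qmap].
  apply/funext => g; apply: qmap_eq; rewrite ?ri ?si; first exact: qs_qmap.
  exact: qr_qmap.
Qed.

Lemma quotient_range_open : open_map r -> open_map (qr r s).
Proof.
move=> or U oU; rewrite (_ : qr r s @` U = r @` (pi @^-1` U)).
  by apply: or; exact: (open_comp (fun x _ => @continuous_qmap x)).
apply/seteqP; split=> _ [q Uq <-].
  by exists (repr q); [rewrite /= qmapK|].
by exists (pi q) => //; exact: qr_qmap.
Qed.

End Quotient.

(** * Lifting a Haar system from the quotient *)

Section RadonSupport.
Context {R : realType} {T : ptopologicalType}.
Hypothesis lT : lch_space T.
Variable mu : {measure set (borel T) -> \bar R}.
Local Open Scope ereal_scope.

Lemma compact_off_support_null (K : set T) : compact K ->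
  (forall t, K t -> ~ msupp mu t) -> mu K = 0.
Proof.
move=> cK Kn.
have /choice[U HU] : forall t, exists U : set T,
    K t -> [/\ open U, U t & mu U = 0].
  move=> t; have [Kt|nK] := pselect (K t); last by exists setT.
  have := Kn t Kt; rewrite /msupp /= => /existsNP[U /not_implyP[oU /not_implyP[Ut]]].
  move=> /negP; rewrite -leNgt => mU; exists U => _; split => //.
  by apply/eqP; rewrite eq_le mU measure_ge0.
have [|s [sK Ks]] := compact_finite_cover (U := U) cK.
  by move=> t /HU[oU Ut _]; exact: open_nbhs_nbhs.
have null (s' : seq T) : {subset s' <= s} ->
    measurable (\big[setU/set0]_(u <- s') U u : set (borel T)) /\
    mu (\big[setU/set0]_(u <- s') U u) = 0.
  elim: s' => [|u s' IH] ss; first by rewrite big_nil measure0.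
  have [ms s0] := IH (fun z zs => ss z (@mem_behead _ (u :: s') z zs)).
  have [oU _ U0] := HU u (sK _ (ss u (mem_head _ _))).
  have mU := open_borel oU; rewrite big_cons; split; first exact: measurableU.
  apply/eqP; rewrite eq_le measure_ge0 andbT.
  have u0 : mu (U u) <= 0 by rewrite U0.
  have t0 : mu (\big[setU/set0]_(u <- s') U u) <= 0 by rewrite s0.
  by have := leeD u0 t0; rewrite adde0; apply: le_trans; exact: measureU2.
have [ms s0] := null s (fun _ h => h).
apply/eqP; rewrite eq_le measure_ge0 andbT -s0; apply: le_measure.
- by rewrite inE; apply: compact_borel => //; exact: lT.2.
- by rewrite inE.
- by move=> t /Ks[u us Uu]; rewrite -bigcup_seq; exists u.
Qed.

Hypothesis rmu : radon_measure mu.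

Lemma open_off_support_null (V : set T) : open V ->
  (forall t, V t -> ~ msupp mu t) -> mu V = 0.
Proof.
move=> oV Vn; have [_ _ ->//] := rmu; apply/eqP; rewrite eq_le; apply/andP; split.
  apply: ge_ereal_sup => _ [K [cK KV] <-].
  by rewrite compact_off_support_null // => t /KV; exact: Vn.
by apply: ereal_sup_ubound; exists set0; [split => //;
  exact: compact0|rewrite measure0].
Qed.

(** The complement of [D] is open and null. This passes between integrals over a range fibre, as in
    the invariance axiom, and integrals over the whole space. *)
Lemma integral_support (D : set T) (f : T -> R) : closed D -> msupp mu = D ->
  Cplus f -> \int[mu]_(t in D) (f t)%:E = \int[mu]_t (f t)%:E.
Proof.
move=> cD mD Cf; have oD := closed_openC cD.
rewrite [RHS](@ge0_negligible_integral _ _ _ _ _ (~` D : set (borel T))) //.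
- by rewrite setTD setCK.
- exact: open_borel.
- exact: Cplus_measurable.
- by move=> t _; rewrite lee_fin; case: Cf.
- by apply: open_off_support_null => // t nD; rewrite mD.
Qed.

End RadonSupport.

Section HaarSystem.
Context {R : realType} {G : ptopologicalType} {X : topologicalType}.
Variables (r s : G -> X) (e : X -> G) (m : G -> G -> G) (i : G -> G).
Hypothesis gG : is_locally_compact_groupoid r s e m i.
Hypothesis stab_open : forall V : set G, open V -> open (r @` (V `&` stab r s)).

Let rC := continuous_range gG.
Let sC := continuous_source gG.
Let iC := continuous_inverse gG.
Let rM := range_mul gG.
Let sM := source_mul gG.
Let mA := groupoid_mulA gG.
Let me := mul_unitr gG.
Let ri := range_inv gG.
Let si := source_inv gG.
Let lG := lc_lchG gG.
Let hQ := qmap_hausdorff gG.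
Let lQ := qmap_lch gG stab_open.
Local Notation pi := (qmap r s).

Lemma fibre_Cplus_left a (f : G -> R) : Cplus f -> fibre_Cplus r s (s a) (fun t => f
  (m a t)).
Proof.
move=> [cf f0 [K cK fK]]; split => //.
  move=> t W /= fW; have [rt st] := set_valP t.
  have aW : nbhs (m a (set_val t)) (f @^-1` W) by exact: cf.
  have [A [B [aA tB AB]]] := continuous_composable gG (esym rt) aW.
  have : nbhs t (set_val @^-1` B) by exact: initial_continuous.
  apply: filterS => t' Bt'; apply: AB => //; first exact: nbhs_singleton.
  by have [-> _] := set_valP t'.
pose K1 := [set m p.1 p.2 | p in ([set i a] `*` K) `&` composable r s].
exists (set_val @^-1` K1).
  apply: closed_set_val_compact; first exact: (closed_isotropy gG).
  by apply: (compact_composable gG) => //; exact: compact_set1.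
move=> t nK; have [rt st] := set_valP t; apply: fK => Kt; apply: nK.
exists (i a, m a (set_val t)); last by rewrite /= (groupoid_mulVK gG).
by split => //; rewrite /composable /= si rM.
Qed.

Variable I : X -> (G -> R) -> R.
Hypothesis invI : invariant_family r s m I.
Hypothesis locI : local_family r s I.
Hypothesis contI : continuous_family r s I.

(** The equivalence class of [g] is its coset under the isotropy group at [s g]; this integrates [f]
    over that class. *)
Definition fibre_integral (f : G -> R) (g : G) : R := I (s g) (fun t => f (m g t)).

(** [h] is [g] times the isotropy element [m (i g) h], which left invariance absorbs. *)
Lemma fibre_integral_sim f g h : Cplus f -> r g = r h -> s g = s h ->
  fibre_integral f g = fibre_integral f h.
Proof.
move=> Cf rgh sgh; rewrite /fibre_integral -sgh.
have ko : isotropy r s (s g) (m (i g) h) by split; rewrite ?rM ?sM // ?ri ?si.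
have [_ _ _ H _] := invI (s g); rewrite -(H _ _ ko (fibre_Cplus_left g Cf)).
apply: locI => t [rt st]; congr f.
rewrite -mA; last 2 first.
- by rewrite rM ?ri // si.
- by rewrite sM ?si // rt sgh.
by rewrite (groupoid_mulK gG).
Qed.

Lemma invariant_family0 x : I x (fun=> 0) = 0.
Proof.
have [_ _ H _ _] := invI x.
by have := H 0 (fun=> 0) (lexx _) Cplus0; rewrite !mul0r.
Qed.

(** [contI] is applied over [G] with the source map; for [g] in a compact neighbourhood [C] of [g0],
    the integrand vanishes off the compact set of products of inverses from [C] with [K]. *)
Lemma continuous_fibre_integral f : Cplus f -> continuous (fibre_integral f).
Proof.
move=> Cf g0; have [cf f0 [K cK fK]] := Cf.
have [C cC [_ gC]] := lch_nbhs_compact lG (filterT : nbhs g0 setT).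
pose K1 := [set m p.1 p.2 | p in ((i @` C) `*` K) `&` composable r s].
apply: (@contI G s g0 (fun g t => f (m g t)) K1).
- exact: sC.
- by move=> g; exact: fibre_Cplus_left.
- apply: (compact_composable gG) => //; apply: continuous_compact cC.
  by apply: continuous_subspaceT; exact: iC.
- apply: filterS gC => g Cg t [rt st] nK; apply: fK => Kt; apply: nK.
  exists (i g, m g t); last by rewrite /= (groupoid_mulVK gG).
  split; last by rewrite /composable /= si rM.
  by split => //; exists g.
- move=> t0 d [rt0 st0] d0.
  have W : nbhs (m g0 t0) [set z | `|f z - f (m g0 t0)| < d].
    have /cvgrPdist_lt/(_ _ d0) := cf (m g0 t0).
    by apply: filterS => z; rewrite distrC.
  have [A [B [gA tB AB]]] := continuous_composable gG (esym rt0) W.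
  by exists (B, A) => // -[t g] /= [Bt Ag] [rt st]; exact: AB.
Qed.

Definition quotient_integral (f : G -> R) (q : Gbar r s) : R := fibre_integral f (repr
  q).

Lemma quotient_integralE f g : Cplus f ->
  quotient_integral f (pi g) = fibre_integral f g.
Proof.
by move=> Cf; have [rg sg] := qmap_inj (qmapK (pi g)); exact: fibre_integral_sim.
Qed.

Lemma quotient_integral_eq0 f (K : set G) q : (forall t, ~ K t -> f t = 0) ->
  ~ (pi @` K) q -> quotient_integral f q = 0.
Proof.
move=> fK nq; rewrite -(invariant_family0 (s (repr q))).
apply: locI => t [rt st]; apply: fK => Kt; apply: nq; exists (m (repr q) t) => //.
by rewrite -[RHS]qmapK; apply: qmap_eq; rewrite ?rM ?sM.
Qed.

Lemma Cplus_quotient_integral f : Cplus f -> Cplus (quotient_integral f).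
Proof.
move=> Cf; have [cf f0 [K cK fK]] := Cf; split.
- apply/quotient_continuous; rewrite (_ : _ \o _ = fibre_integral f).
    exact: continuous_fibre_integral.
  by apply/funext => g; exact: quotient_integralE.
- move=> q; rewrite /quotient_integral /fibre_integral.
  by have [H _ _ _ _] := invI (s (repr q)); apply: H; exact: fibre_Cplus_left.
- exists (pi @` K); last by move=> q; exact: quotient_integral_eq0.
  by apply: continuous_compact cK; apply: continuous_subspaceT; exact: continuous_qmap.
Qed.

Lemma quotient_integralD f g : Cplus f -> Cplus g ->
  quotient_integral (fun t => f t + g t) = (fun q => quotient_integral f q +
    quotient_integral g q).
Proof.
move=> Cf Cg; apply/funext => q; have [_ H _ _ _] := invI (s (repr q)).
by apply: H; exact: fibre_Cplus_left.
Qed.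

Lemma quotient_integralZ a f : 0 <= a -> Cplus f ->
  quotient_integral (fun t => a * f t) = (fun q => a * quotient_integral f q).
Proof.
move=> a0 Cf; apply/funext => q; have [_ _ H _ _] := invI (s (repr q)).
by apply: H => //; exact: fibre_Cplus_left.
Qed.

Lemma quotient_integral_gt0 f g : Cplus f -> 0 < f g -> 0 < quotient_integral f (pi g).
Proof.
move=> Cf fg; rewrite quotient_integralE // /fibre_integral.
have [_ _ _ _ H] := invI (s g); apply: H; first exact: fibre_Cplus_left.
by exists (e (s g)); [exact: isotropy_id gG (s g)|rewrite me].
Qed.

Variable nu : X -> {measure set (borel (Gbar r s)) -> \bar R}.
Hypothesis hnu : haar_system (qr r s) (qs r s) (qm r s m) nu.

Let nuR x : radon_measure (nu x). Proof. by case: hnu. Qed.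
Let nu_fin x (K : set (Gbar r s)) : compact K -> (nu x K < +oo)%E.
Proof. by case: (nuR x) => H _ _; exact: H. Qed.
Let nuS x : msupp (nu x) = [set q | qr r s q = x]. Proof. by case: hnu. Qed.

Definition lifted_functional x (f : G -> R) : R :=
  fine (\int[nu x]_q (quotient_integral f q)%:E)%E.

Lemma lifted_functionalE x f : Cplus f ->
  (lifted_functional x f)%:E = (\int[nu x]_q (quotient_integral f q)%:E)%E.
Proof.
move=> Cf; rewrite /lifted_functional fineK //.
by apply: (integral_Cplus_fin hQ (@nu_fin x)); exact: Cplus_quotient_integral.
Qed.

Lemma positive_lifted_functional x : positive_functional (lifted_functional x).
Proof.
have [H0 HD HZ] := positive_functional_integral hQ (@nu_fin x).
rewrite /lifted_functional; split.
- by move=> f Cf; apply: H0; exact: Cplus_quotient_integral.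
- move=> f g Cf Cg; rewrite quotient_integralD //.
  by apply: HD; exact: Cplus_quotient_integral.
- move=> a f a0 Cf; rewrite quotient_integralZ //.
  by apply: HZ => //; exact: Cplus_quotient_integral.
Qed.

Lemma lifted_measure_exists : exists mu : X -> {measure set (borel G) -> \bar R},
  forall x, radon_measure (mu x) /\ forall f, Cplus f ->
    (\int[mu x]_g (f g)%:E = \int[nu x]_q (quotient_integral f q)%:E)%E.
Proof.
have H x := riesz_representation lG (positive_lifted_functional x).
exists (fun x => projT1 (cid (H x))) => x; case: cid => mu [rmu muE]; split => //.
by move=> f Cf; rewrite -lifted_functionalE // -muE.
Qed.

Variable mu : X -> {measure set (borel G) -> \bar R}.
Hypothesis muR : forall x, radon_measure (mu x).
Hypothesis muE : forall x f, Cplus f ->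
  (\int[mu x]_g (f g)%:E = \int[nu x]_q (quotient_integral f q)%:E)%E.

Let mu_fin x (K : set G) : compact K -> (mu x K < +oo)%E.
Proof. by case: (muR x) => H _ _; exact: H. Qed.

Lemma lifted_support x : msupp (mu x) = [set g | r g = x].
Proof.
have hX := (lc_lchX gG).2; apply/seteqP; split => g.
  apply: contraPP => /= rgx; rewrite /msupp /= => /(_ (~` [set g | r g = x])).
  have cx : closed [set g | r g = x].
    by apply: closed_equalizer; [exact: hX|exact: rC|move=> z; exact: cst_continuous].
  move=> /(_ (closed_openC cx) rgx); have [_ _ ->] := muR x; last exact: closed_openC.
  apply/negP; rewrite -leNgt; apply: ge_ereal_sup => _ [K [cK Kx] <-].
  (* The quotient integral of [f] vanishes off the image of [C], a compact set missing the support
     of [nu x]; so [K] is null, and by inner regularity so is the complement of the range fibre. *)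
  have [f [Cf f1 fK [C cC [Cx fC]]]] := @lch_bump R G K _ lG cK (closed_openC cx) Kx.
  have mK : measurable (K : set (borel G)) by apply: compact_borel => //; exact: lG.2.
  rewrite -[mu x K]mul1e; apply: (@le_trans _ _ (\int[mu x]_g (f g)%:E)%E).
    by apply: integral_Cplus_ge => // t /fK ->.
  have Cq := Cplus_quotient_integral Cf; have [M M0 qM] := Cplus_bounded Cq.
  have cpC : compact (pi @` C).
    by apply: continuous_compact cC; apply: continuous_subspaceT;
      exact: continuous_qmap.
  rewrite muE //.
  apply: (le_trans (integral_Cplus_le hQ (nu x) Cq cpC (ltW M0) qM _)).
    by move=> q; exact: quotient_integral_eq0.
  rewrite (compact_off_support_null lQ) ?mule0 //.
  by move=> q [g' Cg' <-]; rewrite nuS /= qr_qmap; exact: Cx.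
move=> /= rgx U oU Ug.
have [f [Cf f1 fg [C cC [CU fC]]]] := @lch_bump_pt R G g U lG (open_nbhs_nbhs (conj oU
  Ug)).
have mC : measurable (C : set (borel G)) by apply: compact_borel => //; exact: lG.2.
apply: (@lt_le_trans _ _ (mu x C)); last first.
  by apply: le_measure => //; rewrite inE //; exact: open_borel.
rewrite -[mu x C]mul1e; apply: (@lt_le_trans _ _ (\int[mu x]_g (f g)%:E)%E); last first.
  by apply: integral_Cplus_le => //; exact: lG.2.
rewrite muE //; have Cq := Cplus_quotient_integral Cf; have [cq _ _] := Cq.
have q0 : 0 < quotient_integral f (pi g) by apply: quotient_integral_gt0 => //;
  rewrite fg.
set c := quotient_integral f (pi g) in q0.
(* [V] is an open neighbourhood of a point in the support of [nu x], so it has positive measure, and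
   it forces a positive integral of [f]. *)
pose V := [set q | c / 2 < quotient_integral f q].
have oV : open V.
  exact: (@open_comp _ _ (quotient_integral f) [set z | c / 2 < z] (fun q _ => cq q)
    (@open_gt _ _)).
have Vg : V (pi g) by rewrite /V /= ltr_pdivrMr // ltr_pMr // ltr1n.
have nV : (0 < nu x V)%E.
  have : msupp (nu x) (pi g) by rewrite nuS /= qr_qmap.
  exact.
have c2 : 0 < c / 2 by rewrite divr_gt0.
apply: (@lt_le_trans _ _ ((c / 2)%:E * nu x V)%E); first by rewrite mule_gt0.
by apply: integral_Cplus_ge => //; [exact: open_borel|exact: ltW|move=> q /ltW].
Qed.

Lemma lifted_invariant a f : Cplus f ->
  (\int[mu (s a)]_(g in [set g | r g = s a]) (f (m a g))%:E =
   \int[mu (r a)]_g (f g)%:E)%E.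
Proof.
move=> Cf; have hX := (lc_lchX gG).2; have [cf f0 [K cK fK]] := Cf.
set D := [set g | r g = s a].
have cD : closed D by apply: closed_equalizer; [exact: hX|exact: rC|move=> z;
  exact: cst_continuous].
have cpsi : {within D, continuous (fun g => f (m a g))}.
  apply/subspace_continuousP => t0 rt0 W fW.
  have W1 : nbhs (m a t0) (f @^-1` W) by exact: cf.
  have [A [B [aA tB AB]]] := continuous_composable gG (esym rt0) W1.
  rewrite /= !nbhs_simpl /within /=; apply: filterS tB => t Bt rt.
  by apply: AB => //; exact: nbhs_singleton.
pose K1 := [set m p.1 p.2 | p in ([set i a] `*` K) `&` composable r s].
have cK1 : compact K1.
  by apply: (compact_composable gG) => //; exact: compact_set1.
have fK1 t : D t -> ~ K1 t -> f (m a t) = 0.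
  move=> Dt nK; apply: fK => Kt; apply: nK.
  exists (i a, m a t); last by rewrite /= (groupoid_mulVK gG).
  by split => //; rewrite /composable /= si rM.
(* [m a g] is meaningless off [D], while [muE] needs a function on all of [G]; so the translate is
   extended and made nonnegative. *)
have [h0 [ch0 h0E [C cC hC]]] := lch_tietze lG cD cK1 cpsi fK1.
pose h t := `|h0 t|.
have Ch : Cplus h.
  split; last by exists C => // t nC; rewrite /h hC // normr0.
    by move=> t; apply: continuous_comp; [exact: ch0|exact: norm_continuous].
  by move=> t; exact: normr_ge0.
have hE t : D t -> h t = f (m a t) by move=> Dt; rewrite /h h0E // ger0_norm.
transitivity (\int[mu (s a)]_(g in D) (h g)%:E)%E.
  by apply: eq_integral => t; rewrite inE => Dt; rewrite hE.
rewrite (integral_support lG (muR (s a)) cD (lifted_support _) Ch) !muE //.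
have CQf := Cplus_quotient_integral Cf; have CQh := Cplus_quotient_integral Ch.
have [_ _ Hinv _] := hnu.
have := Hinv _ ((Cc_Cplus _ hQ).1 CQf).1 (pi a).
rewrite qr_qmap qs_qmap => <-.
have cDq : closed [set q | qr r s q = s a].
  by apply: closed_equalizer => //; [exact: (continuous_qr gG)|move=> z;
    exact: cst_continuous].
rewrite -(integral_support lQ (nuR (s a)) cDq (nuS _) CQh).
apply: eq_integral => q; rewrite inE /= => rq; congr EFin.
have aq : s a = r (repr q) by [].
(* Integrating [f] over the class translated by [pi a] amounts to integrating [h] over the class
   [q]. *)
have -> : qm r s m (pi a) q = pi (m a (repr q)).
  by apply: qrs_inj; rewrite ?(qr_qm gG) ?(qs_qm gG) ?qr_qmap ?qs_qmap ?rM ?sM //.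
rewrite quotient_integralE // /quotient_integral /fibre_integral sM //.
apply: locI => t [rt st]; rewrite hE; last by rewrite /D /= rM.
by rewrite mA.
Qed.

Lemma lifted_continuous f : Cplus f ->
  continuous (fun x => \int[mu x]_g (f g)%:E)%E.
Proof.
move=> Cf; rewrite (_ : (fun x => _) = (fun x => \int[nu x]_q (quotient_integral f
  q)%:E)%E).
  have [_ _ _ H] := hnu; apply: H.
  exact: ((Cc_Cplus _ hQ).1 (Cplus_quotient_integral Cf)).1.
by apply/funext => x; exact: muE.
Qed.

Lemma lifted_haar_system : haar_system r s m mu.
Proof.
(* The lifting results concern nonnegative functions; a general [phi] is split into its positive and
   negative parts. *)
have pos_part (phi : G -> R) : Cc phi -> Cplus (fun g => Num.max (phi g) 0).
  move=> [cphi cK]; split.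
  - apply: (@max_fun_continuous _ G R phi (fun=> 0)) => // z; exact: cst_continuous.
  - by move=> t; rewrite le_max lexx orbT.
  - exists (closure [set t | phi t != 0]) => // t nt.
    have -> : phi t = 0 by apply/eqP/negPn/negP => ft; apply: nt; exact: subset_closure.
    by rewrite maxxx.
have neg (phi : G -> R) : Cc phi -> Cc (fun g => - phi g).
  move=> [cphi cK]; split; first by move=> t; apply: cvgN; exact: cphi.
  by rewrite (_ : [set t | - phi t != 0] = [set t | phi t != 0]) //;
    apply/funext => t; rewrite /= oppr_eq0.
have split_int (D : set G) (psi : G -> R) x : (\int[mu x]_(g in D) (psi g)%:E =
    \int[mu x]_(g in D) (Num.max (psi g) 0)%:E -
    \int[mu x]_(g in D) (Num.max (- psi g) 0)%:E)%E.
  by rewrite integralE; congr (_ - _)%E; apply: eq_integral => g _;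
    rewrite ?funeposE ?funenegE EFin_max.
split.
- exact: muR.
- exact: lifted_support.
- move=> phi Cphi a; rewrite split_int [RHS]split_int.
  by rewrite (lifted_invariant a (pos_part _ Cphi)) (lifted_invariant a (pos_part _
    (neg _ Cphi))).
- move=> phi Cphi.
  rewrite (_ : (fun x => _) = (fun x => \int[mu x]_g (Num.max (phi g) 0)%:E -
    \int[mu x]_g (Num.max (- phi g) 0)%:E)%E); last by apply/funext => x;
      exact: split_int.
  move=> x; apply: cvgeB.
  + apply: fin_num_adde_defr.
    by apply: (integral_Cplus_fin lG.2 (@mu_fin x)); exact: pos_part.
  + by apply: lifted_continuous; exact: pos_part.
  + by apply: lifted_continuous; exact/pos_part/neg.
Qed.

End HaarSystem.

Local Close Scope ring_scope.

Theorem theorem2p6 (R : realType) (G : ptopologicalType) (X : topologicalType)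
    (r s : G -> X) (e : X -> G) (m : G -> G -> G) (i : G -> G) :
  is_locally_compact_groupoid r s e m i ->
  paracompact X ->
  (forall V : set G, open V -> open (r @` (V `&` stab r s))) ->
  [/\ is_locally_compact_groupoid (qr r s) (qs r s) (qe r s e)
        (qm r s m) (qi r s i) /\ open_map (qmap r s),
      (open_map r -> open_map (qr r s)) &
      (has_haar_system R (qr r s) (qs r s) (qm r s m) ->
         has_haar_system R r s m)].
Proof.
move=> gG pX stab_open; split.
- by split; [exact: quotient_lc_groupoid gG stab_open|exact: qmap_open gG stab_open].
- exact: quotient_range_open.
- move=> [nu hnu].
  have [I [invI locI contI]] := isotropy_haar_exists (R := R) gG pX stab_open.
  have [mu muP] := lifted_measure_exists gG invI locI contI hnu.
  exists mu; apply: (lifted_haar_system gG stab_open invI locI contI hnu) => x.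
    by case: (muP x).
  by move=> f; case: (muP x) => _; exact.
Qed.
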